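(* Let $p$ be an odd prime, $m\ge1$, $q$ a prime power with $p\nmid q$, and $K=\overline{\mathbb{F}}_q$. (i) If $\mathrm{PGU}_n(q)$ contains an elementary abelian subgroup $E$ of order $p^{2m}$, not contained in any maximal torus of $\mathrm{PGL}_n(K)$, with $C_{\mathrm{PGU}_n(q)}(E)\cong E\times\mathrm{PGU}_k(q)$ for some $1\le k<n$ and $N_{\mathrm{PGU}_n(q)}(E)/C_{\mathrm{PGU}_n(q)}(E)\cong\mathrm{Sp}_{2m}(p)$, then $p^m\mid n$ and $q\equiv-1\pmod p$. (ii) Conversely, if $p^m\mid n$ and $q\equiv-1\pmod p$, such a subgroup $E$ of $\mathrm{PGU}_n(q)$ exists.
   Context: $\mathrm{PGU}_n(q)$ is viewed as the fixed-point group $\mathrm{PGL}_n(K)^F$ of a Steinberg endomorphism $F$ of $\mathrm{PGL}_n(K)$ (Frobenius composed with transpose-inverse). *)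

(* Defs.v *)
From HB Require Import structures.
From mathcomp Require Import all_boot all_order all_algebra all_fingroup all_solvable all_field.
Set Implicit Arguments. Unset Strict Implicit. Unset Printing Implicit Defensive.
Import GRing.Theory.
Local Open Scope ring_scope.
Local Open Scope group_scope.

(* Matrices of size n are taken in 'M_n.-1.+1 (= 'M_n for n >= 1),
   as in MathComp's {'GL_n[R]}. *)

Section PGU.
Variables (n : nat) (F : finFieldType).

Definition ScalGL : {set {'GL_n[F]}} := [set g | is_scalar_mx (GLval g)].

Fact ScalGL_group_set : group_set ScalGL.
Proof.
apply/group_setP; split; first by rewrite inE GL_1E; apply/is_scalar_mxP; exists 1%R.
move=> x y; rewrite !inE GL_ME => /is_scalar_mxP[a ->] /is_scalar_mxP[b ->].
by apply/is_scalar_mxP; exists (a * b)%R; rewrite scalar_mxM.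
Qed.
Canonical ScalGL_group := Group ScalGL_group_set.

(* PGL_n(F) is the quotient group [set: {'GL_n[F]}] / ScalGL, with elements
   of type coset_of ScalGL. *)

Variable sigma : {rmorphism F -> F}.

(* Steinberg endomorphism A |-> ((A^[sigma])^T)^-1 (Frobenius composed with
   transpose-inverse), where sigma will be x |-> x^q. *)
Definition Ftw (A : 'M[F]_n.-1.+1) : 'M[F]_n.-1.+1 := ((map_mx sigma A)^T)^-1%R.

Definition GU : {set {'GL_n[F]}} := [set g | Ftw (GLval g) == GLval g].

Fact GU_group_set : group_set GU.
Proof.
apply/group_setP; split.
  by rewrite inE GL_1E /Ftw map_mx1 trmx1 invr1.
move=> x y; rewrite !inE /Ftw => /eqP Hx /eqP Hy.
have ux : (map_mx sigma (GLval x))^T \is a GRing.unit.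
  by rewrite -[_ \is a _]/(_ \in unitmx) unitmx_tr map_unitmx GL_unitmx.
have uy : (map_mx sigma (GLval y))^T \is a GRing.unit.
  by rewrite -[_ \is a _]/(_ \in unitmx) unitmx_tr map_unitmx GL_unitmx.
rewrite GL_ME; apply/eqP.
rewrite -[(GLval x * GLval y)%R]/(GLval x *m GLval y) map_mxM trmx_mul.
rewrite -[_ *m _]/((map_mx sigma (GLval y))^T * (map_mx sigma (GLval x))^T)%R.
by rewrite invrM // Hx Hy.
Qed.
Canonical GU_group := Group GU_group_set.

(* PGU_n(q) = GU_n(q) / (scalars), viewed inside PGL_n(F_{q^2}).  This is
   (isomorphic to) PGL_n(K)^F. *)
Definition PGU : {set coset_of ScalGL} := (GU / ScalGL)%g.
Canonical PGU_group := Eval hnf in [group of PGU].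

End PGU.

(* The symplectic group Sp_{2m}(p) over F_p, w.r.t. the standard form
   J = [[0, I_m], [-I_m, 0]]. *)
Section Sp.
Variables (m p : nat).
Definition Jsymp : 'M['F_p]_((2 * m).-1.+1) :=
  \matrix_(i, j) (if (j : nat) == (i + m)%N then 1 else
                  if (i : nat) == (j + m)%N then -1 else 0)%R.
Definition Sp : {set {'GL_(2 * m)['F_p]}} :=
  [set g | (GLval g *m Jsymp *m (GLval g)^T == Jsymp)%R].
End Sp.

(* Maximal tori of PGL_n(K) are the images of the conjugates g D g^-1 of the
   diagonal torus D of GL_n(K).  An element of PGU_n(q) (a coset of scalars
   represented by x in GL_n(F_{q^2})) lies in such a torus iff
   g (iota x) g^-1 is diagonal. *)
Definition in_max_torus (n : nat) (F : finFieldType) (L : fieldType)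
    (iota : {rmorphism F -> L}) (E : {set coset_of (ScalGL n F)}) : Prop :=
  exists g : 'M[L]_n.-1.+1, g \in unitmx /\
    forall x : {'GL_n[F]}, coset (ScalGL n F) x \in E ->
      is_diag_mx (g *m map_mx iota (GLval x) *m invmx g).

Definition good_subgroup (p m q n : nat) (F : finFieldType)
    (sigma : {rmorphism F -> F}) (L : fieldType) (iota : {rmorphism F -> L})
    (E : {group coset_of (ScalGL n F)}) : Prop :=
  [/\ E \subset @PGU n F sigma,
      p.-abelem E /\ #|E| = (p ^ (2 * m))%N,
      ~ in_max_torus iota E,
      exists2 k : nat, (1 <= k < n)%N &
        ('C_(@PGU n F sigma)(E) \isog setX E (@PGU k F sigma))%g
    & (('N_(@PGU n F sigma)(E) / 'C_(@PGU n F sigma)(E)) \isog Sp m p)%g].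

(* Main.v *)
(* (i) Let X be the preimage of E in GL_n(F).  If X were abelian it would be
   simultaneously diagonalizable over L, so some commutator in X is a scalar
   l <> 1; then l^p = 1 as E has exponent p, and l^(q+1) = 1 as l comes from
   unitary matrices, whence p | q + 1.  The radical 'Z(X) / Z of the commutator
   pairing is a proper N(E)-invariant subgroup of E = F_p^(2m).  A faithful
   2m-dimensional F_p-module of Sp_2m(p) has no proper nonzero submodule: it
   suffices to look at the subgroup SL_2(p)^m, any module of which, with every
   central involution z_i acting nontrivially, has dimension at least 2m, while
   the z_i are conjugate in Sp_2m(p).  So the pairing is nondegenerate, and
   conjugation by X grades M_n(F) by the characters of E with all pieces of the
   same dimension; hence p^(2m) | n^2.

   (ii) The Weyl operators W(v), v in F_p^(2m), generate the Schroedinger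
   representation of the extraspecial group of order p^(1+2m) and exponent p on
   the functions on F_p^m; they are unitary because q = -1 mod p.  E is the image
   of the W(v) (x) 1 in dimension n = p^m k.  Every s in Sp_2m(p) is realized by an
   intertwiner of v |-> W(v) and v |-> W(vs), unitary up to a scalar that surjectivity
   of the norm F_(q^2)^* -> F_q^* removes. *)
Require Import Defs.
From HB Require Import structures.
From mathcomp Require Import all_boot all_order all_algebra all_fingroup all_solvable all_field.
From mathcomp Require Import mxrepresentation mxabelem ring zify.

Set Implicit Arguments. Unset Strict Implicit. Unset Printing Implicit Defensive.
Import GRing.Theory.
Local Open Scope group_scope.
Local Open Scope ring_scope.

(** * Modules for powers of SL_2(p) *)

Section SL2Power.
Variables (F : fieldType) (d' : nat) (I : finType).
Local Notation d := d'.+1.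
Variables (U U' : I -> 'M[F]_d) (N : nat).
(** [U i] and [U' i] play the opposite root elements of the i-th SL_2; [w i] is then its Weyl
    element and [z i] its central element -1. *)
Let w i := U i * U' i * U i.
Let z i := w i * w i.
Hypothesis two_neq0 : 2%:R != 0 :> F.
Hypothesis unipU : forall i, (U i - 1) ^+ N = 0.
Hypothesis conjU : forall i, w i * U i = U' i * w i.
Hypothesis zK : forall i, z i * z i = 1.
Hypothesis comm_zU : forall i, z i * U i = U i * z i.
Hypothesis comm_zU' : forall i, z i * U' i = U' i * z i.
Hypothesis commUU : forall i j, i != j -> U i * U j = U j * U i.
Hypothesis commUU' : forall i j, i != j -> U i * U' j = U' j * U i.
Hypothesis commU'U' : forall i j, i != j -> U' i * U' j = U' j * U' i.

Definition SL2_stable (S : {set I}) (V : 'M[F]_d) :=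
  forall i, i \in S -> (V *m U i <= V)%MS /\ (V *m U' i <= V)%MS.

Lemma stable_z S V i : SL2_stable S V -> i \in S -> (V *m z i <= V)%MS.
Proof.
move=> sV iS; have [sU sU'] := sV i iS.
have sw : (V *m w i <= V)%MS.
  rewrite /w -!mulmxE !mulmxA.
  apply: submx_trans (submxMr _ (submx_trans (submxMr _ sU) sU')) sU.
by rewrite /z -mulmxE mulmxA; apply: submx_trans (submxMr _ sw) sw.
Qed.

Lemma comm_z_w i (A : 'M[F]_d) : A * U i = U i * A -> A * U' i = U' i * A -> z i * A = A * z i.
Proof.
move=> h h'.
have hw : GRing.comm A (w i) by do 2?apply: commrM.
by apply/commr_sym; apply: commrM.
Qed.

Lemma stable_kermx S V (A : 'M[F]_d) :
  SL2_stable S V -> {in S, forall i, A * U i = U i * A /\ A * U' i = U' i * A} ->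
  SL2_stable S (V :&: kermx A)%MS.
Proof.
move=> sV cA i iS; have [sU sU'] := sV i iS; have [cU cU'] := cA i iS.
have K B : A * B = B * A -> (V *m B <= V)%MS -> ((V :&: kermx A)%MS *m B <= V :&: kermx A)%MS.
  move=> cB sB; rewrite sub_capmx; apply/andP; split.
    by apply: submx_trans sB; apply/submxMr/capmxSl.
  apply/sub_kermxP; rewrite -mulmxA mulmxE -cB -mulmxE mulmxA.
  by have /sub_kermxP-> := capmxSr V (kermx A); rewrite mul0mx.
by split; apply: K.
Qed.

Lemma stable_mulmx S V (A : 'M[F]_d) :
  SL2_stable S V -> {in S, forall i, A * U i = U i * A /\ A * U' i = U' i * A} ->
  SL2_stable S (V *m A).
Proof.
move=> sV cA i iS; have [sU sU'] := sV i iS; have [cU cU'] := cA i iS.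
by split; rewrite -mulmxA mulmxE ?cU ?cU' -mulmxE mulmxA submxMr.
Qed.

Lemma stableS (S T : {set I}) V : T \subset S -> SL2_stable S V -> SL2_stable T V.
Proof. by move=> /subsetP TS sV i /TS; exact: sV. Qed.

(** With trivial kernel on V, A would map V onto itself, and so would all its powers, against
    [A ^+ N = 0]. *)
Lemma unipotent_kermx_neq0 (V : 'M[F]_d) (A : 'M[F]_d) :
  (V *m A <= V)%MS -> A ^+ N = 0 -> V != 0 -> (V :&: kermx A)%MS != 0.
Proof.
move=> sVA AN V0; apply: contraNneq V0 => K0.
have eqr : \rank (V *m A) = \rank V.
  by have := mxrank_mul_ker V A; rewrite K0 mxrank0 addn0.
have VA : (V <= V *m A)%MS by rewrite -(geq_leqif (mxrank_leqif_sup sVA)) eqr.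
have VAk k : (V <= V *m A ^+ k)%MS.
  elim: k => [|k IH]; first by rewrite expr0 mulmx1.
  by rewrite exprSr -mulmxE mulmxA; apply: submx_trans VA (submxMr _ IH).
by have := VAk N; rewrite AN mulmx0 submx0.
Qed.

Lemma comm_z i j : z i * U j = U j * z i /\ z i * U' j = U' j * z i.
Proof.
have [<-|nij] := eqVneq i j; first by [].
have nji : j != i by rewrite eq_sym.
split; apply: comm_z_w.
- exact: commUU.
- exact: commUU'.
- exact: esym (commUU' nij).
- exact: commU'U'.
Qed.

(** An involution z satisfies [(z - 1)^2 = -2 (z - 1)], and 2 is invertible. *)
Lemma mulmx_zB1_sqr i (A : 'M[F]_d) : A *m (z i - 1) *m (z i - 1) = 0 -> A *m (z i - 1) = 0.
Proof.
have e : (z i - 1) *m (z i - 1) = (- 2%:R) *: (z i - 1).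
  rewrite mulmxE mulrBl !mulrBr zK mul1r !mulr1 scaleNr scaler_nat opprB mulr2n.
  by rewrite -[1 - z i]opprB -opprD.
rewrite -mulmxA e -scalemxAr => /eqP; rewrite scaler_eq0 oppr_eq0 (negPf two_neq0) /=.
by move/eqP.
Qed.

Lemma mulmx_comm_zB1 i j (A : 'M[F]_d) :
  A *m (z i - 1) *m (z j - 1) = A *m (z j - 1) *m (z i - 1).
Proof.
rewrite -!mulmxA !mulmxE; congr (_ * _).
have [h h'] := comm_z i j.
have h2 : z i * z j = z j * z i.
  by rewrite -[_ = _]/(GRing.comm _ _); do ![exact: h | exact: h' | apply: commrM].
by rewrite !mulrBl !mulrBr !mul1r !mulr1 h2 !opprB addrACA [RHS]addrACA; congr (_ + _); rewrite addrC.
Qed.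

(* Split V along the eigenspaces of some z i having both; when every z i is -1
   on V, ker (U i - 1) and the image of U i - 1 are nonzero, stable under the
   other factors, and their ranks add up to that of V. *)
Lemma SL2_power_rank (S : {set I}) (V : 'M[F]_d) :
  SL2_stable S V -> {in S, forall i, V *m (z i - 1) != 0} ->
  (2 * #|S| + \rank (V :&: \bigcap_(i in S) kermx (z i - 1)%R)%MS <= \rank V)%N.
Proof.
have [r] := ubnP (\rank V); elim: r S V => // r IH S V /ltnSE-ler sV nzS.
have cz i j : (z i - 1) * U j = U j * (z i - 1) /\ (z i - 1) * U' j = U' j * (z i - 1).
  by have [h h'] := comm_z i j; rewrite !mulrBl !mulrBr h h' !mul1r !mulr1.
pose Vp i := (V :&: kermx (z i - 1)%R)%MS.
have rkz i : (\rank (V *m (z i - 1)) + \rank (Vp i) = \rank V)%N := mxrank_mul_ker _ _.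
(* If some [z i] has a nonzero fixed vector in V, both its eigenspaces, [Vp i] for 1 and [Vm] for
   -1, have smaller rank than V. *)
have [/existsP[i /andP[iS nzp]]|] := boolP [exists i in S, Vp i != 0].
  pose Vm := V *m (z i - 1).
  pose Sp := [set j in S | Vp i *m (z j - 1) != 0].
  pose Sm := [set j in S | Vm *m (z j - 1) != 0].
  have SpS : Sp \subset S by apply/subsetP => j; rewrite inE => /andP[].
  have SmS : Sm \subset S by apply/subsetP => j; rewrite inE => /andP[].
  (* For j outside both sets, [z j - 1] would send V into [Vp i], which it kills; then
     [(z j - 1)^2], hence [z j - 1], would kill V. *)
  have cS : (#|S| <= #|Sp| + #|Sm|)%N.
    apply: leq_trans (leq_card_setU _ _); apply/subset_leq_card/subsetP => j jS.
    rewrite !inE jS /= -negb_and; apply: contra (nzS j jS) => /andP[/eqP h1 /eqP h2].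
    apply/eqP/mulmx_zB1_sqr; apply/sub_kermxP.
    have sp : (Vp i <= kermx (z j - 1)%R)%MS by apply/sub_kermxP.
    apply: submx_trans sp; rewrite sub_capmx; apply/andP; split; last first.
      by apply/sub_kermxP; rewrite mulmx_comm_zB1.
    rewrite mulmxBr mulmx1; apply: addmx_sub; first exact: stable_z sV jS.
    by rewrite eqmx_opp.
  have Vm0 : Vm != 0 by exact: nzS.
  have IHp : (2 * #|Sp| + \rank (Vp i :&: \bigcap_(j in Sp) kermx (z j - 1)%R)%MS <= \rank (Vp i))%N.
    apply: IH => [||j]; last by rewrite inE => /andP[].
      apply: leq_trans ler; rewrite -(rkz i) -[X in (X < _)%N]add0n ltn_add2r.
      by rewrite lt0n mxrank_eq0.
    by apply: stable_kermx => [|j _]; [exact: stableS sV | exact: cz].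
  have IHm : (2 * #|Sm| + \rank (Vm :&: \bigcap_(j in Sm) kermx (z j - 1)%R)%MS <= \rank Vm)%N.
    apply: IH => [||j]; last by rewrite inE => /andP[].
      apply: leq_trans ler; rewrite -(rkz i) -[X in (X < _)%N]addn0 ltn_add2l.
      by rewrite lt0n mxrank_eq0.
    by apply: stable_mulmx => [|j _]; [exact: stableS sV | exact: cz].
  (* A vector fixed by every [z j] is fixed by [z i], so the common fixed space is counted inside
     [Vp i]. *)
  have le0 : (\rank (V :&: \bigcap_(j in S) kermx (z j - 1)%R)%MS <=
      \rank (Vp i :&: \bigcap_(j in Sp) kermx (z j - 1)%R)%MS)%N.
    apply: mxrankS; rewrite !sub_capmx capmxSl /=; apply/andP; split.
      by apply: submx_trans (capmxSr _ _) _; apply: (bigcapmx_inf i iS).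
    apply/sub_bigcapmxP => j jS; apply: submx_trans (capmxSr _ _) _.
    by apply: (bigcapmx_inf j (subsetP SpS _ jS)).
  rewrite -(rkz i) addnC; apply: leq_trans (leq_add (leq_trans (leq_addr _ _) IHm) IHp).
  rewrite addnA addnC leq_add //; last by rewrite -mulnDr leq_mul2l /= addnC.
(* From here on no [z i] with i in S fixes a nonzero vector of V. *)
rewrite negb_exists => /forallP Vp0'.
have {Vp0'} Vp0 i : i \in S -> Vp i = 0.
  by move=> iS; have := Vp0' i; rewrite iS negbK => /eqP.
have [-> | [i iS]] := set_0Vmem S; first by rewrite cards0 muln0 add0n mxrankS ?capmxSl.
have -> : (V :&: \bigcap_(i in S) kermx (z i - 1)%R)%MS = 0.
  apply/eqP; rewrite -submx0 -(Vp0 i iS) capmxS //; by apply: (bigcapmx_inf i iS).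
rewrite mxrank0 addn0.
have rkU : (\rank (V *m (U i - 1)) + \rank (V :&: kermx (U i - 1)%R)%MS = \rank V)%N := mxrank_mul_ker _ _.
have V0 : V != 0 by apply: contraNneq (nzS i iS) => ->; rewrite mul0mx.
have [sU sU'] := sV i iS.
have sUB : (V *m (U i - 1) <= V)%MS by rewrite mulmxBr mulmx1 addmx_sub ?eqmx_opp.
have W0 : (V :&: kermx (U i - 1)%R)%MS != 0 by apply: unipotent_kermx_neq0.
(* If [U i] were trivial on V, so would be its conjugate [U' i], and then [w i] and [z i]. *)
have X0 : V *m (U i - 1) != 0.
  have w4 : w i * (w i * z i) = 1 by rewrite mulrA zK.
  apply: contraNneq (nzS i iS) => /eqP; rewrite mulmxBr mulmx1 subr_eq0 => /eqP VU.
  have sw : (V *m w i <= V)%MS.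
    rewrite /w -!mulmxE !mulmxA VU; apply: submx_trans (submxMr _ sU') sU.
  have Vw : V *m w i *m U i = V *m w i.
    by have /submxP[D ->] := sw; rewrite -mulmxA VU.
  have : V *m U' i = V.
    move: Vw; rewrite -mulmxA mulmxE conjU -mulmxE mulmxA.
    move/(congr1 (fun A => A *m (w i * z i))).
    by rewrite /= -!(mulmxA _ (w i)) -[w i *m _]/(w i * (w i * z i)) w4 !mulmx1.
  move=> VU'; have Vw1 : V *m w i = V by rewrite /w -!mulmxE !mulmxA VU VU' VU.
  by rewrite mulmxBr mulmx1 /z -mulmxE mulmxA Vw1 Vw1 subrr.
have cU : {in S :\ i, forall j, (U i - 1) * U j = U j * (U i - 1) /\ (U i - 1) * U' j = U' j * (U i - 1)}.
  move=> j; rewrite !inE => /andP[nji jS].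
  by rewrite !mulrBl !mulrBr !mul1r !mulr1 commUU ?commUU' // eq_sym.
have sS : SL2_stable (S :\ i) V by apply: stableS sV; exact: subsetDl.
have IHW := IH (S :\ i) _ _ (stable_kermx sS cU).
have IHX := IH (S :\ i) _ _ (stable_mulmx sS cU).
move: IHW IHX; set rW := \rank (V :&: _)%MS in rkU *; set rX := \rank _ in rkU *.
have rW0 : (0 < rW)%N by rewrite lt0n mxrank_eq0.
have rX0 : (0 < rX)%N by rewrite lt0n mxrank_eq0.
have sub0 (A : 'M[F]_d) j : j \in S :\ i -> (A <= V)%MS -> A != 0 -> A *m (z j - 1) != 0.
  move=> /setD1P[_ jS] AV; apply: contraNneq => h.
  by rewrite -submx0 -(Vp0 j jS) sub_capmx AV; apply/sub_kermxP.
move=> IHW IHX.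
have hW : (2 * #|S :\ i| <= rW)%N.
  apply: leq_trans (leq_addr _ _) (IHW _ _); first by rewrite (leq_trans _ ler) // -rkU -[X in (X < _)%N]add0n ltn_add2r.
  by move=> j jS; apply: sub0 => //; exact: capmxSl.
have hX : (2 * #|S :\ i| <= rX)%N.
  apply: leq_trans (leq_addr _ _) (IHX _ _); first by rewrite (leq_trans _ ler) // -rkU -[X in (X < _)%N]addn0 ltn_add2l.
  by move=> j jS; apply: sub0.
rewrite -rkU (cardsD1 i S) iS mulnDr muln1.
(* With [c = #|S :\ i|], both ranks are at least 1 and at least [2c]. For [c = 0] their sum is at
   least 2; otherwise [4c >= 2c + 2]. *)
case: {IHW IHX sS cU sub0} #|S :\ i| hW hX => [|c] hW hX.
  by rewrite muln0 addn0; apply: (leq_add rX0 rW0).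
apply: leq_trans (leq_add hX hW); rewrite leq_add2r.
by rewrite mulnS leq_addr.
Qed.
End SL2Power.

(** * The subgroup SL_2(p)^m of Sp_2m(p) *)

Section TwoByTwo.
Variable R : comNzRingType.

Definition J2 : 'M[R]_2 := \matrix_(b, c) (if (b < c)%N then 1 else if (c < b)%N then -1 else 0).
Definition upper2 : 'M[R]_2 := 1 + delta_mx 0 1.
Definition lower2 : 'M[R]_2 := 1 - delta_mx 1 0.

Local Ltac mx2 := apply/matrixP => [[[|[|x]] Hx] [[|[|y]] Hy]] //;
  rewrite !(mxE, big_ord_recl, big_ord0) /= ?mulr0n ?mulr1n; ring.

Lemma tr_J2 : J2^T = - J2. Proof. mx2. Qed.

Lemma J2_sqr : J2 *m J2 = - 1%:M. Proof. mx2. Qed.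

Lemma upper2_symp : upper2 *m J2 *m upper2^T = J2. Proof. mx2. Qed.

Lemma lower2_symp : lower2 *m J2 *m lower2^T = J2. Proof. mx2. Qed.

(** The sign in [lower2] is chosen for this identity: the Weyl element of each block becomes [J2],
    with square -1. *)
Lemma weyl2E : upper2 * lower2 * upper2 = J2. Proof. mx2. Qed.

Lemma J2_upper2 : J2 * upper2 = lower2 * J2. Proof. mx2. Qed.

Lemma upper2X k : upper2 ^+ k = 1 + delta_mx 0 1 *+ k.
Proof.
elim: k => [|k IH]; first by rewrite addr0.
rewrite exprSr IH mulrDl mul1r mulrDr mulr1 mulrnAl mulrSr -mulmxE mul_delta_mx_0 //.
by rewrite mul0rn addr0 -addrA; congr (1 + _); rewrite addrC.
Qed.
End TwoByTwo.

(** * Symplectic matrices acting on hyperbolic planes *)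

Section HyperbolicPairs.
Variables (R : comNzRingType) (I : finType) (N' : nat).
Local Notation N := N'.+1.
Variables (J : 'M[R]_N) (hyp : I -> 'M[R]_(2, N)).
Hypothesis hyp_orth : forall i j, hyp i *m (hyp j)^T = (i == j)%:R.
Hypothesis hyp_J : forall i, hyp i *m J = J2 R *m hyp i.
Hypothesis J_hypT : forall i, J *m (hyp i)^T = (hyp i)^T *m J2 R.
Local Notation J2 := (J2 R).

(* A acts on the hyperbolic plane spanned by the rows of hyp i, and 1 on its orthogonal. *)
Definition sl2 i (A : 'M[R]_2) : 'M[R]_N := 1 + (hyp i)^T *m (A - 1) *m hyp i.

Lemma sl2_1 i : sl2 i 1 = 1.
Proof. by rewrite /sl2 subrr mulmx0 mul0mx addr0. Qed.

Lemma mul_hyp2 i j (A B : 'M[R]_2) :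
  ((hyp i)^T *m A *m hyp i) *m ((hyp j)^T *m B *m hyp j) =
  if i == j then (hyp i)^T *m (A *m B) *m hyp i else 0.
Proof.
rewrite !mulmxA -(mulmxA _ (hyp i)) hyp_orth; case: eqVneq => [<-|_].
  by rewrite mulmx1 -!mulmxA.
by rewrite mulmx0 !mul0mx.
Qed.

Lemma sl2_mul i A B : sl2 i A * sl2 i B = sl2 i (A * B).
Proof.
rewrite /sl2 mulrDl !mulrDr !mul1r !mulr1 -!mulmxE mul_hyp2 eqxx -!addrA; congr (1 + _).
rewrite -!mulmxDl -!mulmxDr; congr (_ *m _ *m _).
rewrite [A - 1 + _]addrC mulmxE mulrBr mulr1 mulrBl mul1r -addrA subrK.
by rewrite addrCA [B + _]addrC subrK addrC.
Qed.

Lemma sl2_comm i j A B : i != j -> sl2 i A * sl2 j B = sl2 j B * sl2 i A.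
Proof.
move=> nij; rewrite /sl2 !(mulrDl, mulrDr) !mul1r !mulr1 -!mulmxE !mul_hyp2 (negPf nij) eq_sym (negPf nij).
by rewrite !addr0 -!addrA; congr (_ + _); rewrite addrC.
Qed.

Lemma sl2_inj i : injective (sl2 i).
Proof.
move=> A B /addrI /(congr1 (fun X => hyp i *m X *m (hyp i)^T)).
by rewrite !mulmxA hyp_orth eqxx -!mulmxA hyp_orth eqxx !mulmx1 !mul1mx => /addIr.
Qed.

(** With [A = 1 + B], the condition on A reads [B J2 + J2 B^T + B J2 B^T = 0]; the same expression,
    carried to the plane of [hyp i], is the defect of [sl2 i A]. *)
Lemma sl2_symp i A : A *m J2 *m A^T = J2 -> sl2 i A *m J *m (sl2 i A)^T = J.
Proof.
move=> hA; pose B := A - 1.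
have hB : B *m J2 + (J2 *m B^T + B *m J2 *m B^T) = 0.
  have -> : B^T = A^T - 1 by rewrite /B linearB /= trmx1.
  rewrite /B [(A - 1) *m J2 *m _]mulmxBr mulmxBr !mulmxBl !mulmx1 !mul1mx hA -[J2 - J2 *m A^T]opprB.
  by rewrite addNKr subrr.
have eT : (sl2 i A)^T = 1 + (hyp i)^T *m B^T *m hyp i.
  by rewrite /sl2 -/B [(1 + _)^T]linearD /= trmx1 !trmx_mul trmxK mulmxA.
have e1 : (hyp i)^T *m B *m hyp i *m J = (hyp i)^T *m (B *m J2) *m hyp i.
  by rewrite -!mulmxA hyp_J.
have e2 : J *m ((hyp i)^T *m B^T *m hyp i) = (hyp i)^T *m (J2 *m B^T) *m hyp i.
  by rewrite !mulmxA J_hypT.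
rewrite eT /sl2 -/B mulmxDl mul1mx e1 mulmxDl !mulmxDr !mulmx1 mul_hyp2 eqxx e2.
rewrite -[RHS]addr0 -!addrA; congr (J + _); rewrite addrCA.
by rewrite -!mulmxDl -!mulmxDr hB mulmx0 mul0mx.
Qed.

(** For [i != j] this involution exchanges the two hyperbolic planes; it serves to conjugate the
    central elements of the factors. *)
Definition swap i j : 'M[R]_N := 1 - (hyp i - hyp j)^T *m (hyp i - hyp j).

Lemma swap_symp i j : i != j -> swap i j *m J *m (swap i j)^T = J.
Proof.
move=> nij; rewrite /swap; set D := hyp i - hyp j.
have DJ : D *m J = J2 *m D by rewrite mulmxBl mulmxBr !hyp_J.
have JD : J *m D^T = D^T *m J2 by rewrite linearB /= mulmxBl mulmxBr !J_hypT.
have DD : D *m D^T = 2%:R%:M.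
  rewrite linearB /= mulmxBl !mulmxBr !hyp_orth !eqxx (negPf nij) eq_sym (negPf nij).
  by rewrite subr0 sub0r opprK -mulr2n -scalemx1 scaler_nat.
have -> : (1 - D^T *m D)^T = 1 - D^T *m D.
  by rewrite [(1 - _)^T]linearB /= trmx1 trmx_mul trmxK.
pose K := D^T *m J2 *m D.
have e1 : D^T *m D *m J = K by rewrite -mulmxA DJ mulmxA.
have e2 : J *m (D^T *m D) = K by rewrite mulmxA JD.
have e3 : K *m (D^T *m D) = K + K.
  by rewrite /K mulmxA -(mulmxA _ D) DD mul_mx_scalar -scalemxAl scaler_nat mulr2n.
rewrite mulmxBl mul1mx e1 mulmxBr mulmx1 mulmxBl e2 e3.
by rewrite opprB addrK subrK.
Qed.

Lemma hyp_swap i j : i != j -> hyp i *m swap i j = hyp j.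
Proof.
move=> nij; rewrite /swap mulmxBr mulmx1 mulmxA [(hyp i - hyp j)^T]linearB /= [hyp i *m (_ - _)]mulmxBr !hyp_orth eqxx (negPf nij).
by rewrite subr0 mul1mx opprB addrC subrK.
Qed.

Lemma swap_hypT i j : i != j -> swap i j *m (hyp j)^T = (hyp i)^T.
Proof.
move=> nij; rewrite /swap mulmxBl mul1mx -mulmxA mulmxBl !hyp_orth eqxx (negPf nij).
by rewrite sub0r mulmxN mulmx1 opprK [(hyp i - hyp j)^T]linearB /= addrC subrK.
Qed.

Lemma sl2_swap i j A : i != j -> sl2 i A * swap i j = swap i j * sl2 j A.
Proof.
move=> nij; rewrite /sl2 mulrDl [swap i j * (_ + _)]mulrDr mul1r mulr1; congr (_ + _).
by rewrite -!mulmxE -!mulmxA hyp_swap // !mulmxA swap_hypT.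
Qed.
End HyperbolicPairs.

(** * The standard symplectic form and the group Sp_2m(p) *)

Section Symplectic.
Variables (m p : nat).
Hypothesis m_gt0 : (0 < m)%N.
Local Notation N := (2 * m).-1.+1.
Local Notation J := (Jsymp m p).
Local Notation J2 := (J2 'F_p).

(* The two rows of hyp i are the hyperbolic pair e_i, e_(i+m) of the standard symplectic basis. *)
Definition hyp (i : 'I_m) : 'M['F_p]_(2, N) := \matrix_(b, x) ((x : nat) == (i + b * m)%N)%:R.
Lemma hyp_lt (i : 'I_m) (b : 'I_2) : (i + b * m < N)%N.
Proof. case: i b => i Hi [[|[|b]] Hb] //=; lia. Qed.

Lemma mul_hypE n (i : 'I_m) (A : 'M_(N, n)) b x : (hyp i *m A) b x = A (Ordinal (hyp_lt i b)) x.
Proof.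
rewrite mxE (bigD1 (Ordinal (hyp_lt i b))) //= mxE eqxx mul1r big1 ?addr0 // => y ny.
by rewrite mxE -[(i + _)%N]/(val (Ordinal (hyp_lt i b))) val_eqE (negPf ny) mul0r.
Qed.

Lemma hyp_orth i j : hyp i *m (hyp j)^T = (i == j)%:R.
Proof.
apply/matrixP => b c; rewrite mul_hypE !mxE /=.
have -> : (i + b * m == j + c * m)%N = (i == j) && (b == c).
  rewrite -!val_eqE; case: i j b c => i Hi [j Hj] [[|[|b]] Hb] // [[|[|c]] Hc] //=; lia.
case: (i == j) => /=; last by rewrite mxE.
by rewrite -[1%:R]/(1%:M) mxE.
Qed.

Lemma hyp_J i : hyp i *m J = J2 *m hyp i.
Proof.
apply/matrixP => b x; rewrite mul_hypE !mxE !big_ord_recl big_ord0 !mxE /=.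
case: i b => i Hi [[|[|b]] Hb] //=; rewrite !mul0n !mul1n !addn0 ?mul0r ?mul1r ?add0r ?addr0.
  by case: eqP => // _; case: eqP => //; lia.
case: eqP; first by have := ltn_ord x; lia.
rewrite eqn_add2r (eq_sym i) => _; case: eqP => _; by rewrite mulN1r ?oppr0.
Qed.

Lemma tr_J : J^T = - J.
Proof.
apply/matrixP => x y; rewrite !mxE.
by case: eqP => h; case: eqP => h'; rewrite ?oppr0 ?opprK //; lia.
Qed.

Lemma J_hypT i : J *m (hyp i)^T = (hyp i)^T *m J2.
Proof.
apply: trmx_inj; rewrite !trmx_mul !trmxK tr_J tr_J2 mulmxN mulNmx hyp_J; by [].
Qed.

Lemma hyp_complete : \sum_i (hyp i)^T *m hyp i = 1.
Proof.
apply/matrixP => x y; rewrite summxE -[RHS]/((1%:M : 'M_N) x y) mxE.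
have xm : (x %% m < m)%N by rewrite ltn_mod.
pose i := Ordinal xm.
have xd : (x %/ m < 2)%N by rewrite ltn_divLR //; have := ltn_ord x; lia.
pose b := Ordinal xd.
have xib : (x = i + b * m :> nat)%N by rewrite /= addnC -divn_eq.
have ex (j : 'I_m) (c : 'I_2) : ((x : nat) == j + c * m)%N = (i == j) && (b == c).
  rewrite xib -!val_eqE; move: (i) (b) {xib}; clear.
  case: j c => i Hi [[|[|c]] Hc] // [j Hj] [[|[|b]] Hb] //=; lia.
rewrite (bigD1 i) //= big1 ?addr0.
  rewrite mxE (bigD1 b) //= big1 ?addr0 => [|c nc]; last first.
    by rewrite !mxE ex eqxx /= (eq_sym b) (negPf nc) mul0r.
  by rewrite !mxE ex !eqxx mul1r -xib -val_eqE eq_sym.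
move=> j nj; rewrite mxE big1 // => c _.
by rewrite !mxE ex (eq_sym i) (negPf nj) mul0r.
Qed.

Lemma mul_JJ : J *m J = - 1%:M.
Proof.
rewrite -{2}[J]mulmx1 -[1%:M]hyp_complete !mulmx_sumr -sumrN; apply: eq_bigr => i _.
rewrite (mulmxA J (hyp i)^T) J_hypT -!mulmxA (mulmxA J) J_hypT -!mulmxA (mulmxA J2).
by rewrite J2_sqr mulNmx mul1mx mulmxN.
Qed.

(** Since [J^2 = -1], the relation itself provides the right inverse [- J A^T J]. *)
Lemma symp_unit (A : 'M['F_p]_N) : A *m J *m A^T = J -> A \in unitmx.
Proof.
move=> h; have : A *m (J *m A^T *m - J) = 1%:M.
  by rewrite !mulmxA h mulmxN mul_JJ opprK.
by case/mulmx1_unit.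
Qed.

Lemma in_Sp (g : {'GL_(2 * m)['F_p]}) : (g \in Sp m p) = (GLval g *m J *m (GLval g)^T == J).
Proof. by rewrite inE. Qed.

Fact Sp_group_set : group_set (Sp m p).
Proof.
apply/group_setP; split; first by rewrite in_Sp GL_1E trmx1 mulmx1 mul1mx.
move=> x y; rewrite !in_Sp GL_ME -mulmxE => /eqP hx /eqP hy.
by rewrite trmx_mul !mulmxA -(mulmxA (GLval x)) -(mulmxA (GLval x)) hy hx.
Qed.
Canonical Sp_group := Group Sp_group_set.

Lemma Sp_exists (A : 'M['F_p]_N) : A *m J *m A^T = J -> exists2 g, g \in Sp m p & GLval g = A.
Proof.
move=> h; exists (Sub A (symp_unit h)) => //.
by rewrite in_Sp h.
Qed.

Lemma GLval_inj n (R : finComUnitRingType) : injective (@GLval n R).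
Proof. exact: val_inj. Qed.

Local Notation sl2 := (sl2 hyp).

(** The generators are [upper2] and [lower2] placed in the i-th plane. Blocks on orthogonal planes
    commute, [z i] is -1 on its plane and so differs from 1 for odd p, and [swap i j] conjugates
    [z i] to [z j]. *)
Lemma Sp_SL2_power : prime p -> odd p ->
  exists U U' : 'I_m -> {'GL_(2 * m)['F_p]},
  let w i := (U i * U' i * U i)%g in let z i := (w i * w i)%g in
  [/\ forall i, U i \in Sp m p /\ U' i \in Sp m p,
      forall i, (U i ^+ p = 1)%g,
      forall i, (w i * U i = U' i * w i)%g
    & forall i, [/\ z i * z i = 1, z i != 1, z i * U i = U i * z i & z i * U' i = U' i * z i]%g] /\
  [/\ forall i j, i != j -> (U i * U j = U j * U i)%g,
      forall i j, i != j -> (U i * U' j = U' j * U i)%g,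
      forall i j, i != j -> (U' i * U' j = U' j * U' i)%g
    & forall i j, exists2 s, s \in Sp m p & (z i * s = s * z j)%g].
Proof.
move=> p_pr p_odd.
have exSp A : A *m J2 *m A^T = J2 ->
    exists g : 'I_m -> {'GL_(2 * m)['F_p]}, forall i, g i \in Sp m p /\ GLval (g i) = sl2 i A.
  move=> hA; apply: (@fin_all_exists 'I_m (fun=> {'GL_(2 * m)['F_p]}) (fun i g => g \in Sp m p /\ GLval g = sl2 i A)) => i.
  have [g gS Eg] := Sp_exists (sl2_symp hyp_orth hyp_J J_hypT i hA).
  by exists g.
have M i A B g h : GLval g = sl2 i A -> GLval h = sl2 i B -> GLval (g * h)%g = sl2 i (A * B).
  by move=> Eg Eh; rewrite GL_MxE Eg Eh; exact: (sl2_mul hyp_orth).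
have C i j A B g h : i != j -> GLval g = sl2 i A -> GLval h = sl2 j B -> (g * h = h * g)%g.
  move=> nij Eg Eh; apply: GLval_inj; rewrite GL_MxE [RHS]GL_MxE Eg Eh.
  exact: (sl2_comm hyp_orth).
have E i A B g h : A = B -> GLval g = sl2 i A -> GLval h = sl2 i B -> g = h.
  by move=> <- Eg Eh; apply: GLval_inj; rewrite Eg Eh.
have [U EU] := exSp _ (upper2_symp _); have [U' EU'] := exSp _ (lower2_symp _).
exists U, U' => w z.
have Eu i := (EU i).2; have El i := (EU' i).2.
have E1 i : GLval 1%g = sl2 i 1 by rewrite sl2_1.
have Ew i : GLval (w i) = sl2 i J2 by rewrite -weyl2E; apply: (M) => //; apply: M.
have Ez i : GLval (z i) = sl2 i (-1) by rewrite -[-1]J2_sqr; apply: M.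
do 2!split.
- by split; [exact: (EU i).1 | exact: (EU' i).1].
- move=> i.
  have EX k : GLval (U i ^+ k)%g = sl2 i (upper2 'F_p ^+ k).
    elim: k => [|k IH]; first exact: E1.
    by rewrite expgS; apply: etrans (M _ _ _ _ _ (Eu i) IH) _; congr (sl2 i _); exact: esym (exprS _ _).
  apply: (E i _ _ _ _ _ (EX p) (E1 i)).
  by rewrite upper2X -scaler_nat pchar_Fp_0 // scale0r addr0.
- move=> i; apply: (E i _ _ _ _ (J2_upper2 _)); exact: M.
- move=> i; split.
  + apply: (E i _ _ _ _ _ _ (E1 i)); last exact: M.
    by rewrite mulrNN mulr1.
  + apply/eqP => /(congr1 GLval); rewrite Ez (E1 i) => /(sl2_inj hyp_orth).
    move/matrixP/(_ 0 0); rewrite !mxE eqxx !mulr1n => /eqP.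
    rewrite eq_sym -subr_eq0 opprK -mulr2n.
    by rewrite -(dvdn_pcharf (pchar_Fp p_pr)) dvdn_prime2 // => /eqP p2; rewrite p2 in p_odd.
  + by apply: (E i (-1 * upper2 'F_p) (upper2 'F_p * -1)); [rewrite mulN1r mulrN1 | apply: M | apply: M].
  + by apply: (E i (-1 * lower2 'F_p) (lower2 'F_p * -1)); [rewrite mulN1r mulrN1 | apply: M | apply: M].
- by move=> i j nij; apply: (C _ _ _ _ _ _ nij (Eu i) (Eu j)).
- by move=> i j nij; apply: (C _ _ _ _ _ _ nij (Eu i) (El j)).
- by move=> i j nij; apply: (C _ _ _ _ _ _ nij (El i) (El j)).
- move=> i j; have [<-|nij] := eqVneq i j; first by exists 1%g; rewrite ?group1 // mulg1 mul1g.
  have [s sS Es] := Sp_exists (swap_symp hyp_orth hyp_J J_hypT nij); exists s => //.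
  apply: GLval_inj; rewrite GL_MxE [RHS]GL_MxE !Ez Es.
  exact: (sl2_swap hyp_orth _ nij).
Qed.
End Symplectic.

(** * Faithful modules for a group that contains a power of SL_2(p) *)

Section SL2PowerModule.
Variables (F : fieldType) (p : nat) (d' : nat) (gT : finGroupType) (H : {group gT}).
Variables (rH : mx_representation F H d'.+1) (I : finType) (U U' : I -> gT).
Let w i := (U i * U' i * U i)%g.
Let z i := (w i * w i)%g.
Hypotheses (charF : p \in [pchar F]) (p_odd : odd p).
Hypotheses (mU : forall i, U i \in H) (mU' : forall i, U' i \in H).
Hypothesis Up : forall i, (U i ^+ p = 1)%g.
Hypothesis wU : forall i, (w i * U i = U' i * w i)%g.
Hypothesis zP : forall i,
  [/\ z i * z i = 1, z i != 1, z i * U i = U i * z i & z i * U' i = U' i * z i]%g.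
Hypothesis commUU : forall i j, i != j -> (U i * U j = U j * U i)%g.
Hypothesis commUU' : forall i j, i != j -> (U i * U' j = U' j * U i)%g.
Hypothesis commU'U' : forall i j, i != j -> (U' i * U' j = U' j * U' i)%g.
Hypothesis swapz : forall i j, exists2 s, s \in H & (z i * s = s * z j)%g.
Hypothesis dimI : d'.+1 = (2 * #|I|)%N.
Hypothesis faithful : mx_faithful rH.

Lemma SL2_power_module_rank (S : {set I}) (V : 'M_d'.+1) :
  mxmodule rH V -> {in S, forall i, V *m (rH (z i) - 1) != 0} ->
  (2 * #|S| + \rank (V :&: \bigcap_(i in S) kermx (rH (z i) - 1)%R)%MS <= \rank V)%N.
Proof.
move=> modV nzV.
have p_pr := pcharf_prime charF.
have M x y : x \in H -> y \in H -> rH x * rH y = rH (x * y)%g by move=> Hx Hy; rewrite repr_mxM.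
have mw i : w i \in H by rewrite !groupM.
have mz i : z i \in H by rewrite groupM.
have eqz i : (rH (U i) * rH (U' i) * rH (U i)) * (rH (U i) * rH (U' i) * rH (U i)) = rH (z i).
  by rewrite !M ?groupM.
have two0 : 2%:R != 0 :> F.
  by rewrite -(dvdn_pcharf charF) dvdn_prime2 //; apply: contraL p_odd => /eqP->.
(* In characteristic p, [(x - 1)^p = x^p - 1], and [U i ^+ p = 1]. *)
have unip i : (rH (U i) - 1) ^+ p = 0.
  have AX k : rH (U i) ^+ k = rH (U i ^+ k)%g.
    by elim: k => [|k IH]; rewrite ?expr0 ?repr_mx1 // exprS expgS IH M ?groupX.
  have ch : p \in [pchar 'M[F]_d'.+1] by rewrite pchar_lalg.
  rewrite -(pFrobenius_autE ch) pFrobenius_autB_comm; last exact: commr1.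
  by rewrite !pFrobenius_autE AX Up repr_mx1 expr1n subrr.
have := @SL2_power_rank _ _ _ (rH \o U) (rH \o U') p two0 unip _ _ _ _ _ _ _ S V.
rewrite /=; under eq_bigr do rewrite eqz.
apply.
- by move=> i; rewrite !M ?groupM // wU.
- by move=> i; rewrite eqz M //; case: (zP i) => ->; rewrite repr_mx1.
- by move=> i; rewrite eqz !M //; case: (zP i) => _ _ ->.
- by move=> i; rewrite eqz !M //; case: (zP i) => _ _ _ ->.
- by move=> i j nij; rewrite !M // commUU.
- by move=> i j nij; rewrite !M // commUU'.
- by move=> i j nij; rewrite !M // commU'U'.
- by move=> i _; split; apply: (mxmoduleP modV).
- by move=> i iS; rewrite eqz nzV.
Qed.

(** The [z i] are conjugate, so they act on V all trivially or all nontrivially. In the second case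
    the rank bound on V reaches the full dimension. In the first, V lies in the common fixed space
    of the whole module, which the same bound shows to be zero. *)
Lemma SL2_power_module_simple (V : 'M_d'.+1) :
  mxmodule rH V -> V = 0 \/ \rank V = d'.+1.
Proof.
move=> modV.
have mz i : z i \in H by rewrite !groupM.
have swapV i j : V *m (rH (z i) - 1) = 0 -> V *m (rH (z j) - 1) = 0.
  have [s Hs zs] := swapz j i.
  rewrite !mulmxBr !mulmx1 => /eqP; rewrite subr_eq0 => /eqP Vz; apply/eqP; rewrite subr_eq0; apply/eqP.
  have -> : z j = (s * z i * s^-1)%g by rewrite -zs mulgK.
  have /submxP[D eD] := mxmoduleP modV s Hs.
  rewrite (repr_mxM rH (groupM Hs (mz i))) ?groupV // (repr_mxM rH Hs (mz i)) !mulmxA eD -(mulmxA D) Vz -eD.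
  by rewrite repr_mxK.
have [i0 _ | I0] := pickP (mem I); last by have := dimI; rewrite eq_card0.
have [V0|V0] := eqVneq (V *m (rH (z i0) - 1)) 0; [left | right].
  have nz1 : {in [set: I], forall i, (1%:M : 'M_d'.+1) *m (rH (z i) - 1) != 0}.
    move=> i _; rewrite mul1mx subr_eq0; apply/eqP => zi1.
    have : z i \in rker rH by apply/rkerP.
    by move/(subsetP faithful)/set1P/eqP; apply/negP; case: (zP i).
  have := SL2_power_module_rank (mxmodule1 rH) nz1.
  rewrite cardsT -dimI mxrank1 -[X in (_ <= X)%N]addn0 leq_add2l leqn0 mxrank_eq0 => /eqP E0.
  apply/eqP; rewrite -submx0 -E0 sub_capmx submx1 /=; apply/sub_bigcapmxP => i _.
  by apply/sub_kermxP; apply: swapV V0.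
have nzV : {in [set: I], forall i, V *m (rH (z i) - 1) != 0}.
  by move=> i _; apply: contraNneq V0 => h; apply/eqP/(swapV i).
apply/eqP; rewrite eqn_leq rank_leq_row /= {1}dimI -cardsT.
exact: leq_trans (leq_addr _ _) (SL2_power_module_rank modV nzV).
Qed.
End SL2PowerModule.

(** * Invariant subgroups of an elementary abelian group with automizer Sp_2m(p) *)

Section SpInvariant.
Variables (m p : nat) (gT : finGroupType) (G E R : {group gT}).
Hypotheses (p_pr : prime p) (p_odd : odd p) (m_gt0 : (0 < m)%N).
Hypotheses (nEG : G \subset 'N(E)) (abelE : p.-abelem E) (cardE : #|E| = (p ^ (2 * m))%N).
Hypothesis isoSp : (G / 'C_G(E))%g \isog Sp m p.
Hypotheses (sRE : R \subset E) (nRG : G \subset 'N(R)).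

(** The isomorphism with Sp_2m(p) is abstract, so E is treated as an arbitrary faithful module of
    dimension 2m; [SL2_power_module_simple] makes it simple. *)
Lemma Sp_invariant_subgroup : R :=: 1%g \/ R :=: E.
Proof.
have ntE : E :!=: 1%g.
  by rewrite -cardG_gt1 cardE -(expn0 p) ltn_exp2l ?muln_gt0 ?prime_gt1.
pose rG := abelem_repr abelE ntE nEG.
have dimE : ((abelem_dim' E).+1 = 2 * m)%N.
  by rewrite (dim_abelemE abelE ntE) cardE pfactorK.
have sK : 'C_G(E)%g \subset rker rG by rewrite rker_abelem.
have nK : G \subset 'N('C_G(E)%g) by rewrite -(rker_abelem abelE ntE nEG) rker_norm.
pose rQ := quo_repr sK nK.
have /isogP[f injf imf] : Sp_group m p \isog (G / 'C_G(E))%g by rewrite isog_sym.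
(* Sp_2m(p) acts through [f], whose target is the quotient of G by the kernel of [rG]. *)
pose A s := rQ (f s).
have fQ s : s \in Sp m p -> f s \in (G / 'C_G(E))%g by move=> sS; rewrite -imf mem_morphim.
have rS_repr : mx_repr (Sp_group m p) A.
  split=> [|x y Sx Sy]; first by rewrite /A morph1 repr_mx1.
  by rewrite /A morphM // repr_mxM // fQ.
pose rS := MxRepresentation rS_repr.
have faithS : mx_faithful rS.
  apply/subsetP => s /rkerP[sS As]; apply/set1P; apply: (injmP injf) => //.
  rewrite morph1; have : f s \in rker rQ by apply/rkerP; split; [exact: fQ | exact: As].
  by rewrite rker_quo rker_abelem trivg_quotient => /set1P.
pose V := rowg_mx (abelem_rV abelE ntE @* R)%g.
have modV : mxmodule rS V.
  have modGV : mxmodule rG V by rewrite mxmodule_abelemG.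
  apply/mxmoduleP => s sS; have /morphimP[x nx Gx Ef] := fQ s sS.
  rewrite -[rS s]/(rQ (f s)) Ef quo_repr_coset //; exact: (mxmoduleP modGV).
have cardV : #|R| = (p ^ \rank V)%N.
  by have := card_rowg V; rewrite card_Fp // rowg_mxK card_injm ?abelem_rV_injm.
have [U [U' [[memU Up wU hz] [cUU cUU' cU'U' swapz]]]] := Sp_SL2_power m_gt0 p_pr p_odd.
have dimI : ((abelem_dim' E).+1 = 2 * #|'I_m|)%N by rewrite card_ord.
have [V0|rV] := SL2_power_module_simple (pchar_Fp p_pr) p_odd (fun i => (memU i).1)
  (fun i => (memU i).2) Up wU hz cUU cUU' cU'U' swapz dimI faithS modV.
  by left; apply/eqP; rewrite trivg_card1 cardV V0 mxrank0.
by right; apply/eqP; rewrite eqEcard sRE cardE cardV rV dimE leqnn.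
Qed.
End SpInvariant.

(** * Subgroups of PGL_n and the commutator pairing *)

Section ScalGL.
Variables (n : nat) (F : finFieldType).
Local Notation Z := (ScalGL n F).
Local Notation N := n.-1.+1.

Lemma ScalGLP (x : {'GL_n[F]}) :
  reflect (exists2 a, a != 0 & GLval x = a%:M) (x \in Z).
Proof.
rewrite inE; apply: (iffP is_scalar_mxP) => [[a Ex]|[a _ Ex]]; exists a => //.
have := GL_unit x; rewrite Ex; apply: contraTneq => ->.
by rewrite -[_ \is a _]/(_ \in unitmx) unitmxE det_scalar expr0n /= unitr0.
Qed.

Lemma ScalGL_comm (x y : {'GL_n[F]}) : x \in Z -> (x * y = y * x)%g.
Proof.
case/ScalGLP=> a _ Ex; apply: GLval_inj; rewrite GL_MxE [RHS]GL_MxE Ex.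
exact: esym (scalar_mxC _ _).
Qed.

Lemma ScalGL_norm : 'N(Z) = [set: {'GL_n[F]}].
Proof.
apply/eqP; rewrite eqEsubset subsetT /=; apply: cents_norm.
by apply/centsP => x _ z Zz; exact/esym/ScalGL_comm.
Qed.

Lemma mem_ScalGL_norm (x : {'GL_n[F]}) : x \in 'N(Z).
Proof. by rewrite ScalGL_norm inE. Qed.

Lemma coset_ScalGL_eq (x y : {'GL_n[F]}) :
  coset Z x = coset Z y -> exists2 a, a != 0 & GLval x = a *: GLval y.
Proof.
move=> Exy; have /ScalGLP[a a0 Ea] : (x * y^-1)%g \in Z.
  by apply: coset_idr; rewrite ?morphM ?morphV ?mem_ScalGL_norm //= Exy mulgV.
exists a => //; rewrite -[x in LHS](mulgKV y) GL_MxE Ea; exact: mul_scalar_mx.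
Qed.

Lemma GL_scaler_inj (y : {'GL_n[F]}) (a b : F) : a *: GLval y = b *: GLval y -> a = b.
Proof.
move/(congr1 (fun A => A *m invmx (GLval y))).
rewrite /= -!scalemxAl mulmxV ?GL_unitmx // !scalemx1 => /matrixP/(_ 0 0).
by rewrite !mxE.
Qed.

Lemma mem_cosetpre_ScalGL (A : {set coset_of Z}) x : (x \in coset Z @*^-1 A) = (coset Z x \in A).
Proof.
apply/idP/idP => [/morphpreP[] //|Ax].
by apply: mem_morphpre Ax; exact: mem_ScalGL_norm.
Qed.

Lemma coset_ScalGLM : {morph coset Z : x y / (x * y)%g}.
Proof. by move=> x y; rewrite morphM ?mem_ScalGL_norm. Qed.

Lemma coset_ScalGLV : {morph coset Z : x / x^-1%g}.
Proof. by move=> x; rewrite morphV ?mem_ScalGL_norm. Qed.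

Lemma coset_ScalGL1 x : (coset Z x == 1%g) = (x \in Z).
Proof. by apply/eqP/idP => [/coset_idr->//|/coset_id//]; exact: mem_ScalGL_norm. Qed.
End ScalGL.

(** * Diagonalizable lifts and maximal tori *)

Lemma separable_Xn_subC (R : fieldType) (p : nat) (c : R) :
  p%:R != 0 :> R -> c != 0 -> separable_poly ('X^p - c%:P).
Proof.
move=> p0 c0; rewrite separable_poly.unlock derivB derivC subr0 derivXn -scaler_nat coprimepZr //.
apply: coprimep_expr; rewrite coprimepX rootE !hornerE.
case: p p0 => [|p _]; first by rewrite eqxx.
by rewrite expr0n sub0r oppr_eq0.
Qed.

(** A is a root of [X^p - c], which splits over L and is separable because p and c are nonzero in
    L. *)
Lemma diagonalizable_exp_scalar (L : closedFieldType) n' (A : 'M[L]_n'.+1) (p : nat) (c : L) :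
  p%:R != 0 :> L -> c != 0 -> A ^+ p = c%:M -> diagonalizable A.
Proof.
move=> p0 c0 Ap; apply/diagonalizableP.
have [rs Ers] := closed_field_poly_normal ('X^p - c%:P).
have p_gt0 : (0 < p)%N by case: p p0 {Ap Ers} => //; rewrite eqxx.
have lc : lead_coef ('X^p - c%:P) = 1 by apply/eqP; exact: monicXnsubC.
rewrite lc scale1r in Ers; exists rs; first by rewrite -separable_prod_XsubC -Ers separable_Xn_subC.
rewrite -Ers; apply: mxminpoly_min.
by rewrite rmorphB /= rmorphXn /= horner_mx_X horner_mx_C Ap subrr.
Qed.

Section Toral.
Variables (n p : nat) (F : finFieldType) (L : closedFieldType) (iota : {rmorphism F -> L}).
Variable E : {group coset_of (ScalGL n F)}.
Local Notation Z := (ScalGL n F).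

(** Each lift of an element of E has a scalar p-th power, hence is diagonalizable over L; commuting
    diagonalizable matrices are so simultaneously. *)
Lemma abelian_preim_toral : prime p -> p%:R != 0 :> F -> p.-abelem E -> abelian (coset Z @*^-1 E) ->
  in_max_torus iota E.
Proof.
move=> p_pr p0 /(abelemP p_pr)[_ expE] abX.
pose X := (coset Z @*^-1 E)%g.
have memX x : (x \in X) = (coset Z x \in E) by exact: mem_cosetpre_ScalGL.
have diagX x : x \in X -> diagonalizable (map_mx iota (GLval x)).
  rewrite memX => Ex.
  have /ScalGLP[c c0 Ec] : (x ^+ p)%g \in Z.
    apply: coset_idr; rewrite ?mem_ScalGL_norm // morphX ?mem_ScalGL_norm //.
    exact: expE.
  apply: (@diagonalizable_exp_scalar _ _ _ p (iota c)).
  - by rewrite -(rmorph_nat iota) fmorph_eq0.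
  - by rewrite fmorph_eq0.
  - rewrite -map_scalar_mx -Ec; elim: p => [|k IH]; first by rewrite map_mx1.
    by rewrite exprS IH expgS GL_MxE map_mxM.
have /codiagonalizableP[P Pu /allP diagP] :
    {in [seq map_mx iota (GLval x) | x <- enum X] &, forall A B, comm_mx A B} /\
    {in [seq map_mx iota (GLval x) | x <- enum X], forall A, diagonalizable A}.
  split=> [_ _ /mapP[x + ->] /mapP[y + ->] | _ /mapP[x + ->]]; rewrite !mem_enum => Xx; last exact: diagX.
  move=> Xy; rewrite /comm_mx -!map_mxM -!GL_MxE; congr (map_mx _ (GLval _)).
  exact: (centsP abX).
exists P; split=> // x Ex; rewrite -conjumx //; apply: diagP.
by apply: map_f; rewrite mem_enum memX.
Qed.
End Toral.

(** The commutant is an F-subspace: the centralizer of the matrix R whose rows are the vectorized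
    [t f]. *)
Lemma card_commutant (n' : nat) (F : finFieldType) (I : finType) (D : {pred I})
    (t : I -> 'M[F]_n'.+1) :
  exists r, #|[set B | [forall f in D, t f *m B == B *m t f]]| = (#|F| ^ r)%N.
Proof.
pose R : 'M[F]_(#|D|, n'.+1 ^ 2) := \matrix_(i < #|D|) mxvec (t (enum_val i)).
exists (\rank 'C(R)%MS); rewrite -card_rowg -(card_imset _ (can_inj mxvecK)); apply: eq_card => v.
rewrite inE; apply/imsetP/idP => [[B + ->]|vR].
  rewrite inE => /forall_inP cB; apply/cent_rowP => i.
  by rewrite rowK mxvecK; apply/eqP/cB/enum_valP.
exists (vec_mx v); last by rewrite vec_mxK.
rewrite inE; apply/forall_inP => f Df.
have /cent_rowP/(_ (enum_rank_in Df f)) : (vec_mx v \in 'C(R))%MS by rewrite vec_mxK.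
by rewrite rowK mxvecK enum_rankK_in // => ->.
Qed.

(** Translation by y multiplies the sum by [chi y]. *)
Lemma sum_character0 (gT : finGroupType) (G : {group gT}) (R : idomainType) (chi : gT -> R) (y : gT) :
  {in G &, {morph chi : x z / (x * z)%g >-> x * z}} -> y \in G -> chi y != 1 ->
  \sum_(x in G) chi x = 0.
Proof.
move=> chiM Gy chiy; set s := \sum_(x in G) _.
have /eqP : s = chi y * s.
  rewrite mulr_sumr /s (reindex_inj (mulgI y)) /=; apply: eq_big => [x|x Gx].
    by rewrite groupMl.
  by rewrite chiM // -(groupMl _ Gy).
rewrite -subr_eq0 -[X in X - _]mul1r -mulrBl mulf_eq0 subr_eq0 eq_sym (negPf chiy) /=.
by move/eqP.
Qed.

(** * The commutator pairing and the grading of the matrix algebra *)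

Section TwistedGrading.
Variables (n : nat) (F : finFieldType) (E : {group coset_of (ScalGL n F)}).
Local Notation Z := (ScalGL n F).
Local Notation gT := {'GL_n[F]}.
Local Notation t e := (GLval (repr (e : coset_of Z))).
Hypothesis abE : abelian E.

(** Lifts of commuting classes commute up to a scalar, which rescaling the lifts does not change. *)
Lemma ScalGL_pairing : exists beta : coset_of Z -> coset_of Z -> F,
  forall e f (x y : gT) , e \in E -> f \in E -> coset Z y = e -> coset Z x = f ->
    beta e f != 0 /\ GLval x *m GLval y = beta e f *: (GLval y *m GLval x).
Proof.
have ex ef : exists b, ef.1 \in E -> ef.2 \in E -> forall (x y : gT),
   coset Z y = ef.1 -> coset Z x = ef.2 -> b != 0 /\ GLval x *m GLval y = b *: (GLval y *m GLval x).
  case: ef => e f /=.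
  have [Ee|] := boolP (e \in E); last by exists 0.
  have [Ef|] := boolP (f \in E); last by exists 0.
  have := @coset_ScalGL_eq _ _ (repr f * repr e)%g (repr e * repr f)%g.
  rewrite !coset_ScalGLM !coset_reprK (centsP abE e Ee f Ef) => -[//|b b0 Eb].
  exists b => _ _ x y Ey Ex.
  have [a a0 Ea] : exists2 a, a != 0 & GLval x = a *: t f.
    by apply: coset_ScalGL_eq; rewrite coset_reprK.
  have [c c0 Ec] : exists2 a, a != 0 & GLval y = a *: t e.
    by apply: coset_ScalGL_eq; rewrite coset_reprK.
  split=> //; rewrite Ea Ec -!scalemxAl -!scalemxAr.
  rewrite !GL_MxE in Eb; rewrite Eb !scalerA; congr (_ *: _).
  ring.
have /fin_all_exists[b Pb] := ex.
by exists (fun e f => b (e, f)) => e f x y Ee Ef Ey Ex; apply: (Pb (e, f)).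
Qed.

Hypothesis cardE : #|E|%:R != 0 :> F.
Hypothesis centerE : 'Z(coset Z @*^-1 E) \subset Z.

(* M_n(F) is the direct sum of the t e *m S, for S the commutant of X and t e a lift
   of e in E; pr e is, up to the factor #|E|, the projection to the summand t e *m S. *)
Lemma card_dvdn_sqr : (#|E| %| n.-1.+1 ^ 2)%N.
Proof.
have [beta betaP] := ScalGL_pairing.
have tu e : t e \in unitmx by exact: GL_unit.
have b0 e f : e \in E -> f \in E -> beta e f != 0.
  by move=> Ee Ef; have [] := betaP e f (repr f) (repr e) Ee Ef (coset_reprK _) (coset_reprK _).
have bt e f : e \in E -> f \in E -> t f *m t e = beta e f *: (t e *m t f).
  by move=> Ee Ef; have [] := betaP e f (repr f) (repr e) Ee Ef (coset_reprK _) (coset_reprK _).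
have bE e f (x y : gT) b : e \in E -> f \in E -> coset Z y = e -> coset Z x = f ->
    GLval x *m GLval y = b *: (GLval y *m GLval x) -> beta e f = b.
  move=> Ee Ef Ey Ex; have [_ ->] := betaP e f x y Ee Ef Ey Ex.
  by rewrite -GL_MxE => /GL_scaler_inj.
have bMl f : f \in E -> {in E &, {morph beta^~ f : e e' / (e * e')%g >-> e * e'}}.
  move=> Ef e e' Ee Ee'; apply: (bE _ _ (repr f) (repr e * repr e')%g);
    rewrite ?groupM ?coset_ScalGLM ?coset_reprK //.
  rewrite !GL_MxE mulmxA (bt e f) // -scalemxAl -mulmxA (bt e' f) // -scalemxAr scalerA; congr (_ *: _).
  by rewrite mulmxA.
have bMr e : e \in E -> {in E &, {morph beta e : f f' / (f * f')%g >-> f * f'}}.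
  move=> Ee f f' Ef Ef'; apply: (bE _ _ (repr f * repr f')%g (repr e));
    rewrite ?groupM ?coset_ScalGLM ?coset_reprK //.
  rewrite !GL_MxE -mulmxA (bt e f') // -scalemxAr [X in _ *: X = _]mulmxA (bt e f) // -scalemxAl scalerA mulrC.
  by rewrite mulmxA.
(* A lift of an element of the radical of [beta] is central in the preimage of E, hence scalar. *)
have nondeg e : e \in E -> {in E, forall f, beta e f = 1} -> e = 1%g.
  move=> Ee be1; rewrite -(coset_reprK e); apply/eqP; rewrite coset_ScalGL1.
  apply: (subsetP centerE); rewrite inE mem_cosetpre_ScalGL coset_reprK Ee /=.
  apply/centP => x; rewrite mem_cosetpre_ScalGL => Ex; apply: GLval_inj.
  have [_] := betaP e _ x (repr e) Ee Ex (coset_reprK _) erefl.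
  by rewrite be1 // scale1r !GL_MxE.
have b1r e : e \in E -> beta e 1%g = 1.
  move=> Ee; apply: (mulfI (b0 e 1%g Ee (group1 E))); by rewrite -bMr ?group1 // mulg1 mulr1.
have bVr e f : e \in E -> f \in E -> beta e f^-1%g = (beta e f)^-1.
  move=> Ee Ef; apply: (mulfI (b0 e f Ee Ef)).
  by rewrite -bMr ?groupV // mulgV b1r // mulfV // b0.
have bsym e f : e \in E -> f \in E -> beta e f = (beta f e)^-1.
  move=> Ee Ef; apply: (bE _ _ (repr f) (repr e)); rewrite ?coset_reprK //.
  by rewrite [t e *m t f]bt // scalerA mulVf ?b0 // scale1r.
have bVl e f : e \in E -> f \in E -> beta e^-1%g f = (beta e f)^-1.
  by move=> Ee Ef; rewrite (bsym e^-1%g f) ?groupV // bVr // invrK -(bsym f e) // -bsym.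
pose S := [set B : 'M[F]_n.-1.+1 | [forall f in E, t f *m B == B *m t f]].
pose kap f (B : 'M[F]_n.-1.+1) := t f *m B *m invmx (t f).
pose pr e B := \sum_(f in E) (beta e f)^-1 *: kap f B.
have kapM f g B : kap f (kap g B) = kap (f * g)%g B.
  have [a a0 Ea] : exists2 a, a != 0 & GLval (repr f * repr g)%g = a *: t (f * g)%g.
    by apply: coset_ScalGL_eq; rewrite coset_ScalGLM !coset_reprK.
  have Ei : invmx (t g) *m invmx (t f) = a^-1 *: invmx (t (f * g)%g).
    rewrite -invmxZ ?unitmx_tr // -?Ea ?GL_unit ?unitfE //.
    by rewrite -![invmx _]/(_^-1) mulmxE -invrM ?GL_unit // GL_ME.
  rewrite /kap !mulmxA -GL_MxE Ea -mulmxA Ei -!scalemxAl -scalemxAr scalerA mulfV // scale1r.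
  by [].
have kapt e f c : e \in E -> f \in E -> c \in S -> kap f (t e *m c) = beta e f *: (t e *m c).
  move=> Ee Ef; rewrite inE => /forall_inP/(_ f Ef)/eqP cf.
  rewrite /kap !mulmxA bt // -!scalemxAl -!mulmxA (mulmxA (t f)) cf mulmxK //.
(* [kap f] acts on [t k *m S] by the scalar [beta k f], so [pr e] acts by a character sum, which
   vanishes for [e != k] by nondegeneracy. *)
have prt e k c : e \in E -> k \in E -> c \in S ->
    pr e (t k *m c) = (if e == k then #|E|%:R else 0) *: (t k *m c).
  move=> Ee Ek Sc; rewrite /pr.
  transitivity ((\sum_(f in E) beta (e^-1 * k)%g f) *: (t k *m c)).
    rewrite scaler_suml; apply: eq_bigr => f Ef; rewrite kapt // scalerA.
    by rewrite bMl ?groupV // bVl.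
  congr (_ *: _); case: eqVneq => [->|nek].
    rewrite mulVg (eq_bigr (fun=> 1)) ?sumr_const // => f Ef.
    by rewrite bsym ?group1 // b1r // invr1.
  have Eek : (e^-1 * k)%g \in E by rewrite groupM ?groupV.
  have /exists_inP[f Ef bf] : [exists f in E, beta (e^-1 * k)%g f != 1].
    apply: contraNT nek; rewrite negb_exists_in => /forall_inP h.
    have /(congr1 (mulg e)) : (e^-1 * k)%g = 1%g by apply: nondeg => // f /h; rewrite negbK => /eqP.
    by rewrite mulKVg mulg1 => ->.
  exact: (sum_character0 (bMr _ Eek) Ef bf).
(* After exchanging the sums, only the term [f = 1] survives, again by nondegeneracy. *)
have sum_pr B : \sum_(e in E) pr e B = #|E|%:R *: B.
  rewrite /pr exchange_big /= (bigD1 1%g) ?group1 //= [X in _ + X]big1 ?addr0.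
    rewrite -scaler_suml (eq_bigr (fun=> 1)) ?sumr_const => [|e Ee]; last by rewrite b1r // invr1.
    by congr (_ *: _); rewrite /kap repr_coset1 GL_1E invmx1 mulmx1 mul1mx.
  move=> f /andP[Ef nf1]; rewrite -scaler_suml.
  have /exists_inP[e Ee be] : [exists e in E, beta f e != 1].
    apply: contraNT nf1; rewrite negb_exists_in => /forall_inP h.
    by apply/eqP/nondeg => // e /h; rewrite negbK => /eqP.
  rewrite (eq_bigr (beta f)) => [|e' Ee']; last by rewrite bsym // invrK.
  by rewrite (sum_character0 (bMr _ Ef) Ee be) scale0r.
(* [pr e B] and [t e] are eigenvectors of [kap f] for the same eigenvalue [beta e f], so their
   quotient commutes with [t f]. *)
have prS e B : e \in E -> invmx (t e) *m pr e B \in S.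
  move=> Ee; rewrite inE; apply/forall_inP => f Ef; apply/eqP.
  have kpr : kap f (pr e B) = beta e f *: pr e B.
    rewrite /kap mulmx_sumr mulmx_suml scaler_sumr [RHS](reindex_inj (mulgI f)) /=.
    apply: eq_big => [g|g Eg]; first by rewrite groupMl.
    rewrite -scalemxAr -scalemxAl -/(kap f _) kapM scalerA bMr //.
    by rewrite invfM mulrA mulfV ?b0 // mul1r.
  have tp : t f *m pr e B = beta e f *: (pr e B *m t f).
    by rewrite scalemxAl -kpr /kap mulmxKV.
  apply: (can_inj (mulKmx (tu e))); rewrite !mulmxA mulmxV // mul1mx.
  have -> : t e *m t f = (beta e f)^-1 *: (t f *m t e) by rewrite (bt e f) // scalerA mulVf ?b0 // scale1r.
  by rewrite -!scalemxAl mulmxK // tp scalerA mulVf ?b0 // scale1r.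
pose Phi (c : {ffun coset_of Z -> 'M[F]_n.-1.+1}) := \sum_(e in E) t e *m c e.
have prPhi (c : {ffun coset_of Z -> 'M[F]_n.-1.+1}) e : {in E, forall e, c e \in S} -> e \in E -> pr e (Phi c) = #|E|%:R *: (t e *m c e).
  move=> cS Ee; rewrite /pr /kap.
  under eq_bigr do rewrite mulmx_sumr mulmx_suml scaler_sumr.
  rewrite exchange_big (bigD1 e) //= [X in _ + X]big1 ?addr0 => [|k /andP[Ek nke]].
    by rewrite -/(pr e (t e *m c e)) prt ?cS // eqxx.
  by rewrite -/(pr e (t k *m c k)) prt ?cS // eq_sym (negPf nke) scale0r.
(* [Phi] is a bijection from the families in S indexed by E, extended by 0 outside E, onto the whole
   matrix algebra. *)
have cardM : (#|S| ^ #|E|)%N = #|{: 'M[F]_n.-1.+1}|.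
  rewrite -(card_pffun_on (0 : 'M[F]_n.-1.+1) (mem E) (mem S)).
  rewrite -(card_in_imset (f := Phi)) => [|c c' /pffun_onP[s1 S1] /pffun_onP[s2 S2] eqPhi].
    apply: eq_card => B; rewrite [RHS]inE; apply/imsetP.
    pose c := [ffun e => if e \in E then #|E|%:R^-1 *: (invmx (t e) *m pr e B) else 0].
    have cS e : e \in E -> c e \in S.
      move=> Ee; rewrite ffunE Ee; have := prS e B Ee; rewrite !inE => /forall_inP h.
      by apply/forall_inP => f /h/eqP hf; rewrite -scalemxAr hf -scalemxAl.
    exists c.
      apply/pffun_onP; split; last by move=> _ /imageP[e Ee ->]; exact: cS.
      by apply/supportP => e nE; rewrite ffunE (negPf nE).
    apply: (scalerI cardE); rewrite -sum_pr /Phi scaler_sumr; apply: eq_bigr => e Ee.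
    by rewrite ffunE Ee -scalemxAr scalerA mulfV // scale1r mulKVmx.
  apply/ffunP => e; have [Ee|nE] := boolP (e \in E); last first.
    by rewrite (supportP s1 _ nE) (supportP s2 _ nE).
  have inS (f : {ffun coset_of Z -> 'M[F]_n.-1.+1}) : {subset image f E <= S} -> {in E, forall e, f e \in S}.
    by move=> sub e' Ee'; apply: sub; apply: image_f.
  have := congr1 (pr e) eqPhi; rewrite !prPhi //; try exact: inS.
  by move/(scalerI cardE)/(can_inj (mulKmx (tu e))).
(* With [#|S| = #|F| ^ r], comparing exponents gives [r * #|E|] equal to the square of the matrix
   size. *)
have [r Er] : exists r, #|S| = (#|F| ^ r)%N by exact: card_commutant.
move: cardM; rewrite Er -expnM card_mx => /eqP; rewrite eqn_exp2l ?finRing_gt1 //.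
by rewrite -mulnn => /eqP <-; exact: dvdn_mull.
Qed.
End TwistedGrading.

Lemma GU_P (n : nat) (F : finFieldType) (sigma : {rmorphism F -> F}) (x : {'GL_n[F]}) :
  reflect ((map_mx sigma (GLval x))^T *m GLval x = 1%:M) (x \in GU n sigma).
Proof.
have ux : (map_mx sigma (GLval x))^T \in unitmx by rewrite unitmx_tr map_unitmx; exact: GL_unit.
rewrite inE; apply: (iffP eqP) => [e | e].
  by rewrite -{2}e; exact: mulmxV.
apply: (can_inj (mulKmx ux)); rewrite e.
exact: (mulmxV ux).
Qed.

Lemma natf_neq0_coprime_card (F : finFieldType) (p q : nat) :
  prime p -> ~~ (p %| q)%N -> #|F| = (q ^ 2)%N -> p%:R != 0 :> F.
Proof.
move=> p_pr npq cF; apply/eqP => p0.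
have pF : p \in [pchar F] by rewrite inE p_pr p0 eqxx.
have cF0 : #|F|%:R = 0 :> F.
  have := expg_cardG (in_setT (1 : F)); rewrite cardsT FinRing.zmodXgE; exact.
have : (p %| #|F|)%N by rewrite (dvdn_pcharf pF) cF0.
by rewrite cF Euclid_dvdX // (negPf npq).
Qed.

Lemma prim_root_prime (F : fieldType) (p : nat) (z : F) :
  prime p -> z ^+ p = 1 -> z != 1 -> p.-primitive_root z.
Proof.
move=> p_pr zp z1; have [k kz kp] := prim_order_exists (prime_gt0 p_pr) zp.
suff <- : k = p by [].
apply/(prime_nt_dvdP p_pr) => //; apply: contraNneq z1 => k1.
by have := prim_expr_order kz; rewrite k1 expr1 => ->.
Qed.

(** * Necessity of the two conditions *)

Section Forward.
Variables (p m q n : nat) (F : finFieldType) (sigma : {rmorphism F -> F}).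
Variables (L : closedFieldType) (iota : {rmorphism F -> L}).
Hypotheses (p_pr : prime p) (p_odd : odd p) (m_gt0 : (0 < m)%N) (n_gt0 : (0 < n)%N).
Hypotheses (npq : ~~ (p %| q)%N) (cardF : #|F| = (q ^ 2)%N).
Hypothesis sigmaE : forall x : F, sigma x = x ^+ q.
Local Notation Z := (ScalGL n F).
Variable E : {group coset_of Z}.
Hypothesis goodE : good_subgroup p m q sigma iota E.

Let X := (coset Z @*^-1 E)%G.

Lemma good_preim_nonabelian : ~~ abelian X.
Proof.
have [_ [abelE _] ntor _ _] := goodE; apply/negP => abX; apply: ntor.
apply: (abelian_preim_toral iota p_pr) => //.
exact: natf_neq0_coprime_card npq cardF.
Qed.

Lemma good_dvdn_qS : (p %| q.+1)%N.
Proof.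
have [sEG [abelE _] _ _ _] := goodE.
have /(abelemP p_pr)[abE expE] := abelE.
have lift x : x \in X -> exists2 y, y \in GU n sigma & coset Z x = coset Z y.
  rewrite mem_cosetpre_ScalGL => /(subsetP sEG)/morphimP[y _ GUy Exy].
  by exists y.
(* Noncommuting elements of X may be replaced by unitary lifts of their classes, since scalar
   factors do not affect commutation. *)
have [x Gx [y Gy [Xx Xy nxy]]] : exists2 x, x \in GU n sigma & exists2 y, y \in GU n sigma &
    [/\ x \in X, y \in X & (x * y != y * x)%g].
  have /subsetPn[x Xx nCx] := good_preim_nonabelian.
  have /exists_inP[y Xy nxy] : [exists y in X, (x * y != y * x)%g].
    apply: contraR nCx; rewrite negb_exists_in => /forall_inP h.
    by apply/centP => y /h; rewrite negbK => /eqP.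
  have [x' Gx' Ex] := lift x Xx; have [y' Gy' Ey] := lift y Xy.
  exists x' => //; exists y' => //.
  move: (Xx) (Xy); rewrite !mem_cosetpre_ScalGL Ex Ey => Xx' Xy'; split=> //.
  apply: contraNneq nxy => cxy; apply/eqP/GLval_inj.
  have [a _ Ea] := coset_ScalGL_eq Ex; have [b _ Eb] := coset_ScalGL_eq Ey.
  rewrite !GL_MxE Ea Eb -!scalemxAl -!scalemxAr !scalerA mulrC; congr (_ *: _).
  exact: (congr1 GLval cxy).
have [beta betaP] := ScalGL_pairing abE.
rewrite !mem_cosetpre_ScalGL in Xx Xy.
set e := coset Z y; set f := coset Z x.
have [l0 lE] := betaP _ _ x y Xy Xx erefl erefl; set l := beta _ _ in l0 lE.
have l1 : l != 1.
  apply: contraNneq nxy => l1; apply/eqP/GLval_inj; rewrite !GL_MxE lE l1; exact: scale1r.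
(* Moving the scalar matrix [x ^+ p] past y produces the factor [l ^+ p]. *)
have lp : l ^+ p = 1.
  have xpZ : (x ^+ p)%g \in Z by rewrite -coset_ScalGL1 morphX ?mem_ScalGL_norm //= expE.
  have lk k : GLval (x ^+ k * y)%g = l ^+ k *: GLval (y * x ^+ k)%g.
    elim: k => [|k IH]; first by rewrite mul1g mulg1 scale1r.
    rewrite expgS -mulgA GL_MxE IH -scalemxAr mulgA !GL_MxE !mulmxA lE -!scalemxAl scalerA.
    by rewrite exprSr.
  have := lk p; rewrite ScalGL_comm // -[LHS]scale1r => /esym.
  exact: GL_scaler_inj.
(* Both [x * y] and [y * x] are unitary and they differ by the factor l, so l has norm 1. *)
have lq : l ^+ q.+1 = 1.
  have Gxy : (x * y)%g \in GU_group n sigma by rewrite groupM.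
  have Gyx : (y * x)%g \in GU_group n sigma by rewrite groupM.
  have /GU_P := Gxy; rewrite [in X in X -> _]GL_MxE lE -GL_MxE map_mxZ [(_ *: _)^T]linearZ /= -scalemxAl -scalemxAr.
  have /GU_P -> := Gyx; rewrite scalerA scalemx1 sigmaE -exprSr => /matrixP/(_ 0 0).
  by rewrite !mxE eqxx !mulr1n.
by rewrite (prim_order_dvd (prim_root_prime p_pr lp l1)) lq.
Qed.

Lemma good_dvdn_n : (p ^ m %| n)%N.
Proof.
have [sEG [abelE cardE] _ _ isoN] := goodE.
have /(abelemP p_pr)[abE _] := abelE.
have nX : X \subset 'N(Z) by rewrite ScalGL_norm subsetT.
have sZX : Z \subset X by exact: sub_cosetpre.
have sZ : Z \subset 'Z(X).
  rewrite subsetI sZX; apply/centsP => x Zx y _; exact: ScalGL_comm.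
have XE : (X / Z)%g = E :> {set _} by exact: cosetpreK.
pose G := ('N_(PGU n sigma)(E))%G.
have CG : 'C_G(E) = 'C_(PGU n sigma)(E).
  by rewrite /= -setIA (setIidPr (cent_sub E)).
(* The center is characteristic in X, so its image, the radical of the pairing, is invariant under
   the normalizer of E. *)
have nRG : G \subset 'N('Z(X) / Z)%g.
  rewrite -(cosetpreK G); apply/quotient_norms/(char_norm_trans (center_char X)).
  by apply: morphpre_norms; exact: subsetIr.
have sR : ('Z(X) / Z \subset E)%g by rewrite -XE quotientS ?center_sub.
have isoG : (G / 'C_G(E))%g \isog Sp m p by rewrite CG.
(* With trivial radical, [p ^ (2 * m)] divides [n ^ 2], whence [p ^ m] divides n. With radical E, X
   would be abelian. *)
have [R1|RE] := Sp_invariant_subgroup p_pr p_odd m_gt0 (subsetIr _ _) abelE cardE isoG sR nRG.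
  have sZZ : 'Z(X) \subset Z by rewrite -quotient_sub1 ?R1 // (subset_trans (center_sub _)).
  have := card_dvdn_sqr abE _ sZZ; rewrite cardE prednK // mulnC expnM dvdn_pexp2r //; apply.
  by rewrite -expnM mulnC natrX expf_neq0 // (natf_neq0_coprime_card _ npq cardF).
case/negP: good_preim_nonabelian; apply: subset_trans (subsetIr X _).
by rewrite -(quotientSGK nX sZ) -[('Z(X) / Z)%g]/(gval _) RE XE.
Qed.
End Forward.

(** * Weyl operators *)

Section Weyl.
Variables (m p : nat) (F : fieldType) (zeta : F).
Hypotheses (p_pr : prime p) (p_odd : odd p) (m_gt0 : (0 < m)%N).
Hypotheses (zetap : zeta ^+ p = 1) (zeta1 : zeta != 1) (p0 : p%:R != 0 :> F).
Local Notation N := (2 * m).-1.+1.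
Local Notation J := (Jsymp m p).
Local Notation V := 'rV['F_p]_N.

(** The exponent is the natural number representing x; [zeta ^+ p = 1] makes this an additive
    character. *)
Definition addchar (x : 'F_p) : F := zeta ^+ x.
Local Notation chi := addchar.

Lemma addcharD x y : chi (x + y) = chi x * chi y.
Proof. by rewrite /addchar -exprD /= [X in (_ %% X)%N]Fp_cast // expr_mod. Qed.

Lemma addchar0 : chi 0 = 1. Proof. by []. Qed.

Lemma addchar_neq0 x : chi x != 0.
Proof.
apply/eqP => x0; have := addcharD x (- x).
by rewrite subrr x0 mul0r addchar0 => /eqP; rewrite oner_eq0.
Qed.

Lemma addcharN x : chi (- x) = (chi x)^-1.
Proof. by apply: (mulfI (addchar_neq0 x)); rewrite -addcharD subrr mulfV ?addchar_neq0. Qed.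

Lemma prim_zeta : p.-primitive_root zeta.
Proof. exact: prim_root_prime. Qed.

Lemma addchar_eq1 x : chi x = 1 -> x = 0.
Proof.
move/eqP; rewrite -(prim_order_dvd prim_zeta) => xp; apply: val_inj => /=.
have xlt : (x < p)%N by rewrite -[X in (_ < X)%N](Fp_cast p_pr) ltn_ord.
by move: xp; case: (val x) xlt => // k kp /(dvdn_leq (ltn0Sn k)); rewrite leqNgt kp.
Qed.

Lemma addchar_root (c : F) : c ^+ p = 1 -> exists x, c = chi x.
Proof.
move=> cp; have [i Ei] := prim_rootP prim_zeta cp.
exists (i : nat)%:R; rewrite Ei /addchar val_Fp_nat // modn_small //.
Qed.

Definition sform (v w : V) : 'F_p := (v *m J *m w^T) 0 0.

Lemma sformDl u v w : sform (u + v) w = sform u w + sform v w.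
Proof. by rewrite /sform !mulmxDl mxE. Qed.

Lemma sformDr u v w : sform u (v + w) = sform u v + sform u w.
Proof. by rewrite /sform [(v + w)^T]linearD /= mulmxDr mxE. Qed.

Lemma sform_nondeg v : (forall w, sform v w = 0) -> v = 0.
Proof.
move=> h; have vJ : v *m J = 0.
  apply/rowP => i; have := h (delta_mx 0 i).
  by rewrite /sform trmx_delta -colE mxE => ->; rewrite mxE.
by rewrite -[v]mulmx1 -[1%:M]opprK -(mul_JJ p m_gt0) mulmxN mulmxA vJ mul0mx oppr0.
Qed.

Lemma sform_Sp (s : 'M['F_p]_N) v w : s *m J *m s^T = J -> sform (v *m s) (w *m s) = sform v w.
Proof. by move=> hs; rewrite /sform -[in RHS]hs trmx_mul !mulmxA. Qed.

(** [posn] and [momn] are the coordinates along the e_i and along the e_(i+m), the two Lagrangian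
    halves of the symplectic basis. *)
Definition posn (v : V) : 'rV['F_p]_m := \row_i (v *m (hyp p i)^T) 0 0.
Definition momn (v : V) : 'rV['F_p]_m := \row_i (v *m (hyp p i)^T) 0 1.
Definition phasept (a b : 'rV['F_p]_m) : V :=
  \sum_i (\row_c (if c == 0 then a 0 i else b 0 i)) *m hyp p i.
Definition dot (a b : 'rV['F_p]_m) : 'F_p := \sum_i a 0 i * b 0 i.

Lemma posnD u v : posn (u + v) = posn u + posn v.
Proof. by apply/rowP => i; rewrite !mxE -big_split; apply: eq_bigr => j _; rewrite !mxE mulrDl. Qed.

Lemma momnD u v : momn (u + v) = momn u + momn v.
Proof. by apply/rowP => i; rewrite !mxE -big_split; apply: eq_bigr => j _; rewrite !mxE mulrDl. Qed.

Lemma posnN v : posn (- v) = - posn v.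
Proof. by apply/rowP => i; rewrite !mxE -sumrN; apply: eq_bigr => j _; rewrite !mxE mulNr. Qed.

Lemma momnN v : momn (- v) = - momn v.
Proof. by apply/rowP => i; rewrite !mxE -sumrN; apply: eq_bigr => j _; rewrite !mxE mulNr. Qed.

Lemma phasept_hyp a b i : phasept a b *m (hyp p i)^T = \row_c (if c == 0 then a 0 i else b 0 i).
Proof.
rewrite mulmx_suml (bigD1 i) //= big1 => [|j nj]; last first.
  by rewrite -mulmxA hyp_orth // (_ : (j == i) = false) ?mulmx0 //; exact: negPf nj.
by rewrite addr0 -mulmxA hyp_orth // eqxx mulmx1.
Qed.

Lemma posn_phasept a b : posn (phasept a b) = a.
Proof. by apply/rowP => i; rewrite mxE phasept_hyp mxE eqxx. Qed.

Lemma momn_phasept a b : momn (phasept a b) = b.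
Proof. by apply/rowP => i; rewrite mxE phasept_hyp mxE. Qed.

Lemma phaseptK v : phasept (posn v) (momn v) = v.
Proof.
rewrite -[RHS]mulmx1 -[1%:M](hyp_complete p m_gt0) mulmx_sumr /phasept; apply: eq_bigr => i _.
rewrite mulmxA; congr (_ *m _); apply/rowP => c; rewrite mxE [posn v 0 i]mxE [momn v 0 i]mxE.
by case: c => [[|[|c]] Hc] //=; congr ((_ *m _) 0 _); apply: val_inj.
Qed.

Lemma dotDl a b c : dot (a + b) c = dot a c + dot b c.
Proof. by rewrite /dot -big_split; apply: eq_bigr => i _; rewrite mxE mulrDl. Qed.

Lemma dotC a b : dot a b = dot b a.
Proof. by apply: eq_bigr => i _; rewrite mulrC. Qed.

Lemma dotDr a b c : dot a (b + c) = dot a b + dot a c.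
Proof. by rewrite dotC dotDl !(dotC a). Qed.

Lemma dotNl a b : dot (- a) b = - dot a b.
Proof. by rewrite /dot -sumrN; apply: eq_bigr => i _; rewrite mxE mulNr. Qed.

Lemma dotNr a b : dot a (- b) = - dot a b.
Proof. by rewrite dotC dotNl dotC. Qed.

Lemma dot0l a : dot 0 a = 0.
Proof. by rewrite /dot big1 // => i _; rewrite mxE mul0r. Qed.

Lemma dot_nondeg a : (forall b, dot b a = 0) -> a = 0.
Proof.
move=> h; apply/rowP => i; have := h (delta_mx 0 i).
rewrite /dot (bigD1 i) //= big1 => [|j nj]; first by rewrite !mxE !eqxx mul1r addr0.
by rewrite !mxE (negPf nj) mul0r.
Qed.

Lemma J2_form (x y : 'rV['F_p]_2) : (x *m J2 _ *m y^T) 0 0 = x 0 0 * y 0 1 - x 0 1 * y 0 0.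
Proof.
rewrite !(mxE, big_ord_recl, big_ord0) /=.
have -> : lift ord0 ord0 = 1 :> 'I_2 by exact: val_inj.
ring.
Qed.

Lemma sform_dot v w : sform v w = dot (posn v) (momn w) - dot (momn v) (posn w).
Proof.
rewrite /sform -[v in LHS]mulmx1 -[1%:M](hyp_complete p m_gt0) mulmx_sumr !mulmx_suml summxE.
rewrite /dot -sumrB; apply: eq_bigr => i _.
have -> : v *m ((hyp p i)^T *m hyp p i) *m J *m w^T = (v *m (hyp p i)^T) *m J2 _ *m (w *m (hyp p i)^T)^T.
  by rewrite trmx_mul trmxK !mulmxA -(mulmxA _ (hyp p i) J) hyp_J // !mulmxA.
rewrite [posn v 0 i]mxE [momn v 0 i]mxE [posn w 0 i]mxE [momn w 0 i]mxE.
exact: J2_form.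
Qed.

Local Notation D := #|{: 'rV['F_p]_m}|.
Local Notation idx := (@enum_val 'rV['F_p]_m predT).
Let half : 'F_p := 2%:R^-1.

(* The phase half * (posn . momn) makes the cocycle of weyl alternating and Sp-invariant. *)
Definition weyl (v : V) : 'M[F]_D :=
  \matrix_(x, y) (if idx y == idx x + posn v then chi (dot (momn v) (idx x) + half * dot (posn v) (momn v)) else 0).
Local Notation W := weyl.

Lemma half_sum (x : 'F_p) : half * x + half * x = x.
Proof.
rewrite -mulrDl -[half + half]mulr2n -[half *+ 2]mulr_natl mulfV ?mul1r //.
by rewrite -(dvdn_pcharf (pchar_Fp p_pr)) dvdn_prime2 //; apply: contraL p_odd => /eqP->.
Qed.

Lemma sum_idx (R : nmodType) (f : 'rV['F_p]_m -> R) : \sum_(x < D) f (idx x) = \sum_a f a.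
Proof.
by rewrite [RHS](reindex idx) //=; exists enum_rank => a _; rewrite ?enum_valK ?enum_rankK.
Qed.

Lemma mul_weylE (A : 'M[F]_D) v x y :
  (W v *m A) x y = chi (dot (momn v) (idx x) + half * dot (posn v) (momn v)) * A (enum_rank (idx x + posn v)) y.
Proof.
rewrite mxE (bigD1 (enum_rank (idx x + posn v))) //= big1 ?addr0 => [|z nz].
  by rewrite mxE enum_rankK eqxx.
by rewrite mxE ifN ?mul0r //; apply: contraNneq nz => <-; rewrite enum_valK.
Qed.

Lemma weylM v w : W v *m W w = chi (half * sform v w) *: W (v + w).
Proof.
apply/matrixP => x y; rewrite mul_weylE [RHS]mxE !mxE enum_rankK posnD momnD addrA.
case: eqP => _; last by rewrite !mulr0.
rewrite -!addcharD; congr (chi _); rewrite sform_dot !(dotDl, dotDr).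
rewrite -[dot (momn w) (posn v) in LHS]half_sum (dotC (momn w) (posn v)) (dotC (momn v) (posn w)).
ring.
Qed.

Lemma weyl0 : W 0 = 1%:M.
Proof.
apply/matrixP => x y; have posn0 : posn 0 = 0 by apply: (addrI (posn 0)); rewrite -posnD !addr0.
have momn0 : momn 0 = 0 by apply: (addrI (momn 0)); rewrite -momnD !addr0.
rewrite !mxE posn0 momn0 addr0 !dot0l mulr0 addr0 (inj_eq enum_val_inj) eq_sym.
by case: eqP.
Qed.

Lemma addchar_sum (a : 'rV['F_p]_m) : a != 0 -> \sum_b chi (dot a b) = 0.
Proof.
move=> a0; have /existsP[b cb] : [exists b, chi (dot a b) != 1].
  apply: contraNT a0; rewrite negb_exists => /forallP h; apply/eqP/dot_nondeg => b.
  by apply: addchar_eq1; rewrite dotC; have := h b; rewrite negbK => /eqP.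
have := @sum_character0 _ [set: 'rV['F_p]_m]%G _ (fun b => chi (dot a b)) b.
rewrite (eq_bigl predT) => [->|c]; rewrite ?inE // => x y _ _.
by rewrite dotDr addcharD.
Qed.

(** For [v != 0], either the position shift is nonzero and the diagonal vanishes, or the diagonal
    lists the values of a nontrivial character, whose sum is zero. *)
Lemma weyl_tr v : \tr (W v) = if v == 0 then D%:R else 0.
Proof.
case: eqP => [->|/eqP v0]; first by rewrite weyl0 mxtrace1.
rewrite /mxtrace; have [pv|pv] := eqVneq (posn v) 0; last first.
  by rewrite big1 // => x _; rewrite mxE -[X in X == _]addr0 (inj_eq (addrI _)) eq_sym (negPf pv).
have mv : momn v != 0.
  apply: contraNneq v0 => mv; rewrite -(phaseptK v) pv mv /phasept big1 // => i _.
  by rewrite (_ : \row_c _ = 0) ?mul0mx //; apply/rowP => c; rewrite !mxE if_same.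
rewrite -[RHS](addchar_sum mv) -sum_idx; apply: eq_bigr => x _.
by rewrite mxE pv addr0 eqxx dot0l mulr0 addr0.
Qed.

(** Commuting with the multiplications [W (phasept 0 b)] forces A to be diagonal; commuting with the
    translations [W (phasept a 0)] makes its diagonal constant. *)
Lemma weyl_commutant (A : 'M[F]_D) : (forall v, W v *m A = A *m W v) -> exists c, A = c%:M.
Proof.
move=> cA; pose i0 := enum_rank (0 : 'rV['F_p]_m).
have AW v x y : chi (dot (momn v) (idx x) + half * dot (posn v) (momn v)) * A (enum_rank (idx x + posn v)) y
   = A x (enum_rank (idx y - posn v)) * chi (dot (momn v) (idx y - posn v) + half * dot (posn v) (momn v)).
  rewrite -mul_weylE cA mxE (bigD1 (enum_rank (idx y - posn v))) //= big1 ?addr0 => [|z nz].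
    by rewrite mxE enum_rankK subrK eqxx.
  by rewrite mxE ifN ?mulr0 //; apply: contraNneq nz => ->; rewrite addrK enum_valK.
exists (A i0 i0); apply/matrixP => x y; rewrite [RHS]mxE; case: eqVneq => [<-|nxy].
  have := AW (phasept (idx x) 0) i0 x.
  rewrite posn_phasept momn_phasept !dot0l !(dotC _ 0) dot0l mulr0 addr0 mul1r mulr1.
  by rewrite enum_rankK add0r subrr enum_valK.
rewrite mulr0n; apply/eqP; apply: contraNT nxy => Axy.
suff : idx x - idx y = 0 by move/eqP; rewrite subr_eq0 (inj_eq enum_val_inj).
apply: dot_nondeg => b; apply: addchar_eq1.
have := AW (phasept 0 b) x y.
rewrite posn_phasept momn_phasept dot0l mulr0 !addr0 subr0 !enum_valK mulrC => /(mulfI Axy) E.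
by rewrite dotDr dotNr addcharD E addcharN mulfV ?addchar_neq0.
Qed.

Lemma card_phase : #|{: V}| = (D ^ 2)%N.
Proof.
rewrite !card_mx !card_Fp // !mul1n -expnM; congr (p ^ _)%N.
by rewrite prednK ?muln_gt0 // mulnC.
Qed.

Lemma natD_neq0 : D%:R != 0 :> F.
Proof. by rewrite card_mx card_Fp // mul1n natrX expf_neq0. Qed.
End Weyl.

(** * Intertwiners between a Weyl system and its symplectic twists *)

Section WeylSystem.
Variables (F : fieldType) (V : finZmodType) (D : nat).
Variables (W : V -> 'M[F]_D) (gam : V -> V -> F).
Hypothesis gam0 : forall v w, gam v w != 0.
Hypothesis gamDl : forall u v w, gam (u + v) w = gam u w * gam v w.
Hypothesis gamDr : forall u v w, gam u (v + w) = gam u v * gam u w.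
Hypothesis gamvv : forall v, gam v v = 1.
Hypothesis WM : forall v w, W v *m W w = gam v w *: W (v + w).
Hypothesis W0 : W 0 = 1%:M.
Hypothesis W_commutant : forall A : 'M[F]_D, (forall v, W v *m A = A *m W v) -> exists c, A = c%:M.
Hypothesis W_tr : forall v, \tr (W v) = if v == 0 then D%:R else 0.
Hypothesis cardV : #|V| = (D ^ 2)%N.
Hypothesis D0 : D%:R != 0 :> F.

Lemma gam0l w : gam 0 w = 1.
Proof. by apply: (mulfI (gam0 0 w)); rewrite -gamDl addr0 mulr1. Qed.

Lemma gam0r w : gam w 0 = 1.
Proof. by apply: (mulfI (gam0 w 0)); rewrite -gamDr addr0 mulr1. Qed.

Lemma gamNl v w : gam (- v) w = (gam v w)^-1.
Proof. by apply: (mulfI (gam0 v w)); rewrite -gamDl subrr gam0l mulfV. Qed.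

Lemma gamNr v w : gam v (- w) = (gam v w)^-1.
Proof. by apply: (mulfI (gam0 v w)); rewrite -gamDr subrr gam0r mulfV. Qed.

Lemma gamC v w : gam v w * gam w v = 1.
Proof. by have := gamvv (v + w); rewrite gamDl !gamDr !gamvv mul1r mulr1. Qed.

Lemma WV v : W v *m W (- v) = 1%:M.
Proof. by rewrite WM gamNr gamvv invr1 scale1r subrr. Qed.

Lemma WVl v : W (- v) *m W v = 1%:M.
Proof. by rewrite WM gamNl gamvv invr1 scale1r addNr. Qed.

(** Conjugation by [W w] permutes the terms, the cocycle factors cancelling by [gamC], so the sum
    lies in the commutant. *)
Lemma W_average (Y : 'M[F]_D) : exists c, \sum_v W v *m Y *m W (- v) = c%:M.
Proof.
apply: W_commutant => w; set T := \sum_v _.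
have conjT : W w *m T *m W (- w) = T.
  rewrite mulmx_sumr mulmx_suml /T [RHS](reindex_inj (addrI w)); apply: eq_bigr => v _.
  rewrite !mulmxA WM -(mulmxA _ (W (- v))) WM -!scalemxAl -scalemxAr scalerA.
  by rewrite gamNl gamNr invrK gamC scale1r opprD [- w - v]addrC.
by rewrite -[in RHS]conjT -[RHS]mulmxA WVl mulmx1.
Qed.

Section Intertwiner.
Variable s : V -> V.
Hypotheses (sD : {morph s : v w / v + w}) (s_inj : injective s).
Hypothesis s_gam : forall v w, gam (s v) (s w) = gam v w.

(** Averaging an arbitrary Y makes it intertwine W with the composite of W and s. *)
Definition intertwiner Y := \sum_v W (- v) *m Y *m W (s v).

Lemma intertwinerP Y w : W w *m intertwiner Y = intertwiner Y *m W (s w).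
Proof.
rewrite mulmx_sumr mulmx_suml (reindex_inj (addrI w)); apply: eq_bigr => v _.
have g : gam w (- (w + v)) = gam v w.
  by rewrite gamNr gamDr gamvv mul1r; apply: (mulfI (gam0 w v)); rewrite mulfV // gamC.
rewrite !mulmxA WM g -[RHS]mulmxA WM -!scalemxAl -scalemxAr s_gam opprD addNKr sD.
by rewrite [s w + s v]addrC.
Qed.

(** The [W (s v)] are orthogonal for the trace: multiplying by [W (- s w)] and taking traces
    isolates [c w]. *)
Lemma W_free (c : V -> F) : \sum_v c v *: W (s v) = 0 -> forall v, c v = 0.
Proof.
move=> E w; have := congr1 (fun A => \tr (A *m W (- s w))) E.
rewrite mul0mx linear0 mulmx_suml raddf_sum (bigD1 w) //= big1 => [|v nvw].
  by rewrite addr0 -scalemxAl WV linearZ /= mxtrace1 => /eqP; rewrite mulf_eq0 (negPf D0) orbF => /eqP.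
rewrite -scalemxAl WM !linearZ /= W_tr subr_eq0 (inj_eq s_inj) (negPf nvw).
by rewrite !mulr0.
Qed.

(** If all elementary matrices averaged to zero, the entries [W (- v) i0 i1] would be the
    coefficients of a linear relation between the [W (s v)], although the one at [v = 0] is
    nonzero. *)
Lemma intertwiner_neq0 : exists Y, intertwiner Y != 0.
Proof.
have D_gt0 : (0 < D)%N by rewrite lt0n; apply: contraNneq D0 => ->.
pose i0 := Ordinal D_gt0.
have [i1 i1W] : exists i1, W (- 0) i0 i1 != 0.
  apply/existsP; apply: contraNT (oner_neq0 F); rewrite negb_exists => /forallP h.
  have : (1%:M : 'M[F]_D) i0 i0 = 0.
    rewrite -(WVl 0) mxE big1 // => j _.
    by have := h j; rewrite negbK => /eqP->; rewrite mul0r.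
  by rewrite mxE eqxx => /eqP.
have [/existsP[t /existsP[y nz]]|] := boolP [exists t, exists y, (intertwiner (delta_mx i1 t)) i0 y != 0].
  by exists (delta_mx i1 t); apply: contraNneq nz => ->; rewrite mxE.
rewrite negb_exists => /forallP h.
have := @W_free (fun v => W (- v) i0 i1) _ 0 => E.
move: i1W; rewrite E ?eqxx //; apply/matrixP => t y; rewrite [RHS]mxE.
have := h t; rewrite negb_exists => /forallP/(_ y); rewrite negbK => /eqP <-.
rewrite /intertwiner !summxE; apply: eq_bigr => v _; rewrite mxE.
rewrite -mulmxA mxE (bigD1 i1) //= big1 ?addr0 => [|j nj].
  rewrite mxE (bigD1 t) //= big1 ?addr0 => [|j nj]; first by rewrite mxE !eqxx mul1r.
  by rewrite mxE (negPf nj) andbF mul0r.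
by rewrite mxE big1 ?mulr0 // => k _; rewrite mxE (negPf nj) mul0r.
Qed.

(** If [u *m M = 0], intertwining gives [u *m W w *m M = 0] for all w, so u is killed by the average
    of any [M *m Y']. That average is a scalar, nonzero as soon as [M *m Y'] has nonzero trace,
    because [#|V| = D ^ 2] is nonzero in F. *)
Lemma intertwiner_unit Y : intertwiner Y != 0 -> intertwiner Y \in unitmx.
Proof.
set M := intertwiner Y => M0; rewrite -row_free_unit -kermx_eq0.
have [Y' nY'] : exists Y', \tr (M *m Y') != 0.
  have /matrix0Pn[i [j Mij]] := M0; exists (delta_mx j i).
  rewrite /mxtrace (bigD1 i) //= big1 ?addr0 => [|k nk].
    rewrite mxE (bigD1 j) //= big1 ?addr0 => [|l nl]; first by rewrite mxE !eqxx mulr1.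
    by rewrite mxE (negPf nl) mulr0.
  by rewrite mxE big1 // => l _; rewrite mxE (negPf nk) andbF mulr0.
apply: contraT; case/rowV0Pn => u /sub_kermxP uM /negP u0.
have [c Ec] := W_average (M *m Y').
case: u0; have cu : c *: u = 0.
  rewrite -mul_mx_scalar -Ec mulmx_sumr big1 // => w _.
  by rewrite !mulmxA -(mulmxA u) intertwinerP mulmxA uM !mul0mx.
have c0 : c != 0.
  apply: contraNneq nY' => c0; have := congr1 mxtrace Ec; rewrite c0 mxtrace_scalar mul0rn raddf_sum /=.
  rewrite (eq_bigr (fun=> \tr (M *m Y'))) => [|v _]; last by rewrite mxtrace_mulC !mulmxA WVl mul1mx.
  by rewrite sumr_const cardV -mulr_natl natrX => /eqP; rewrite mulf_eq0 expf_eq0 (negPf D0) andbF.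
by apply/eqP; apply: (scalerI c0); rewrite cu scaler0.
Qed.
End Intertwiner.
End WeylSystem.

(** * Kronecker products and the commutant of a tensor factor *)

Section Tensor.
Variables (R : comNzRingType) (N D K : nat) (e : 'I_N -> 'I_D * 'I_K) (e' : 'I_D * 'I_K -> 'I_N).
Hypotheses (eK : cancel e e') (e'K : cancel e' e).

Definition tens (A : 'M[R]_D) (B : 'M[R]_K) : 'M[R]_N :=
  \matrix_(x, y) (A (e x).1 (e y).1 * B (e x).2 (e y).2).

Lemma sum_tens (f : 'I_N -> R) : \sum_x f x = \sum_i \sum_j f (e' (i, j)).
Proof.
rewrite pair_big (reindex e') /=; last by exists e => x _; rewrite ?eK ?e'K.
by apply: eq_bigr => -[].
Qed.

Lemma tensM A A' B B' : tens A B *m tens A' B' = tens (A *m A') (B *m B').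
Proof.
apply/matrixP => x y; rewrite !mxE sum_tens big_distrlr /=.
by apply: eq_bigr => i _; apply: eq_bigr => j _; rewrite !mxE e'K /=; ring.
Qed.

Lemma tens1 : tens 1%:M 1%:M = 1%:M.
Proof.
apply/matrixP => x y; rewrite !mxE -(inj_eq (can_inj eK)) -natrM mulnb.
by case: (e x) (e y) => i j [i' j'].
Qed.

Lemma tr_tens A B : (tens A B)^T = tens A^T B^T.
Proof. by apply/matrixP => x y; rewrite !mxE. Qed.

Lemma tensZl c A B : tens (c *: A) B = c *: tens A B.
Proof. by apply/matrixP => x y; rewrite !mxE mulrA. Qed.

Lemma tensZr c A B : tens A (c *: B) = c *: tens A B.
Proof. by apply/matrixP => x y; rewrite !mxE mulrCA. Qed.

Lemma tens1_inj (i : 'I_D) : injective (tens 1%:M).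
Proof.
move=> B B' /matrixP eqB; apply/matrixP => j j'.
by have := eqB (e' (i, j)) (e' (i, j')); rewrite !mxE !e'K /= eqxx !mul1r.
Qed.

(** Cut A into D x D slices, one for each pair of indices of the second factor. Each slice commutes
    with all [W v], so it is scalar, and these scalars are the entries of B. *)
Lemma tens_commutant (V : Type) (W : V -> 'M[R]_D) (A : 'M[R]_N) :
  (forall B : 'M[R]_D, (forall v, W v *m B = B *m W v) -> exists c, B = c%:M) ->
  (forall v, tens (W v) 1%:M *m A = A *m tens (W v) 1%:M) -> exists B, A = tens 1%:M B.
Proof.
move=> Wcomm Acomm.
pose slice i j : 'M[R]_D := \matrix_(x, y) A (e' (x, i)) (e' (y, j)).
have /(fin_all_exists (T := ('I_K * 'I_K)%type))[b Eb] : forall ij : 'I_K * 'I_K, exists c, slice ij.1 ij.2 = c%:M.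
  move=> [i j]; apply: Wcomm => v; apply/matrixP => x y.
  have /matrixP/(_ (e' (x, i)) (e' (y, j))) := Acomm v.
  rewrite !mxE !sum_tens /= => E; transitivity (\sum_z W v x z * A (e' (z, i)) (e' (y, j))).
    by apply: eq_bigr => z _; rewrite mxE.
  transitivity (\sum_z A (e' (x, i)) (e' (z, j)) * W v z y); last by apply: eq_bigr => z _; rewrite [in RHS]mxE.
  have -> : \sum_z W v x z * A (e' (z, i)) (e' (y, j)) =
      \sum_z \sum_l tens (W v) 1%:M (e' (x, i)) (e' (z, l)) * A (e' (z, l)) (e' (y, j)).
    apply: eq_bigr => z _; rewrite (bigD1 i) //= big1 ?addr0 => [|l nl].
      by rewrite !mxE !e'K /= eqxx mulr1.
    by rewrite !mxE !e'K /= eq_sym (negPf nl) mulr0 mul0r.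
  rewrite E; apply: eq_bigr => z _; rewrite (bigD1 j) //= big1 ?addr0 => [|l nl].
    by rewrite !mxE !e'K /= eqxx mulr1.
  by rewrite !mxE !e'K /= (negPf nl) !mulr0.
exists (\matrix_(i, j) b (i, j)); apply/matrixP => x y.
have := Eb ((e x).2, (e y).2) => /matrixP/(_ (e x).1 (e y).1).
by rewrite !mxE -!surjective_pairing !eK mulr_natl => ->.
Qed.
End Tensor.

Lemma map_tens (R S : comNzRingType) (f : {rmorphism R -> S}) N D K (e : 'I_N -> 'I_D * 'I_K) A B :
  map_mx f (tens e A B) = tens e (map_mx f A) (map_mx f B).
Proof. by apply/matrixP => x y; rewrite !mxE rmorphM. Qed.

(* F^* is cyclic of order (q - 1)(q + 1), so the elements of order dividing q - 1 are (q + 1)-st powers. *)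
Lemma norm_surjective (F : finFieldType) (q : nat) (c : F) :
  (1 < q)%N -> #|F| = (q ^ 2)%N -> c != 0 -> c ^+ q = c -> exists2 a, a != 0 & a ^+ q.+1 = c.
Proof.
move=> q_gt1 cardF c0 cq.
have /cyclicP[w Ew] := field_unit_group_cyclic [set: {unit F}]%G.
have ow : #[w]%g = (q.-1 * q.+1)%N.
  rewrite orderE -Ew card_finField_unit cardF; lia.
have : FinRing.unit F (etrans (unitfE c) c0) \in <[w]>%g by rewrite -Ew inE.
case/cycleP => j Ej.
have cE : c = val w ^+ j by rewrite -FinRing.val_unitX -Ej.
have wq : (w ^+ (j * q.-1) = 1)%g.
  apply: val_inj; rewrite FinRing.val_unitX exprM -cE.
  by apply: (mulfI c0); rewrite -exprS prednK ?(ltnW q_gt1) // cq mulr1.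
have : (#[w]%g %| j * q.-1)%N by rewrite order_dvdn wq.
rewrite ow mulnC dvdn_pmul2r; last by rewrite -subn1 subn_gt0.
case/dvdnP => i Ei; exists (val w ^+ i); last by rewrite -exprM -Ei.
by rewrite expf_neq0 // -unitfE; exact: valP.
Qed.

(** Every element of F_p is a multiple of 1, so additive maps are linear. *)
Lemma additive_rV_mx (p N M : nat) (phi : 'rV['F_p]_N -> 'rV['F_p]_M) (u : 'rV['F_p]_N) :
  {morph phi : v w / v + w} -> phi u = u *m (\matrix_i phi (delta_mx 0 i)).
Proof.
move=> phiD.
have phi0 : phi 0 = 0 by apply: (addrI (phi 0)); rewrite -phiD !addr0.
have phiZ (a : 'F_p) v : phi (a *: v) = a *: phi v.
  rewrite -[a]natr_Zp !scaler_nat; elim: (val a) => [|k IH]; first by rewrite !mulr0n.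
  by rewrite !mulrS phiD IH.
rewrite [u in LHS]row_sum_delta (big_morph _ phiD phi0) mulmx_sum_row; apply: eq_bigr => i _.
by rewrite phiZ rowK.
Qed.

Lemma GL_exists (n : nat) (R : finComUnitRingType) (A : 'M[R]_n.-1.+1) :
  A \in unitmx -> exists g : {'GL_n[R]}, GLval g = A.
Proof. by move=> uA; exists (Sub A uA). Qed.

(** * The subgroup of PGU_n(q) defined by the Weyl operators *)

Section WeylGroup.
Variables (p m q n k : nat) (F : finFieldType) (sigma : {rmorphism F -> F}).
Local Notation N := (2 * m).-1.+1.
Local Notation V := 'rV['F_p]_N.
Local Notation J := (Jsymp m p).
Variables (D : nat) (W : V -> 'M[F]_D) (gam : V -> V -> F).
Variables (e : 'I_n.-1.+1 -> 'I_D * 'I_k.-1.+1) (e' : 'I_D * 'I_k.-1.+1 -> 'I_n.-1.+1).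
Hypotheses (p_pr : prime p) (m_gt0 : (0 < m)%N) (q_gt1 : (1 < q)%N) (cardF : #|F| = (q ^ 2)%N).
Hypothesis sigmaE : forall x : F, sigma x = x ^+ q.
Hypotheses (eK : cancel e e') (e'K : cancel e' e).
Hypothesis gam0 : forall v w, gam v w != 0.
Hypothesis gamDl : forall u v w, gam (u + v) w = gam u w * gam v w.
Hypothesis gamDr : forall u v w, gam u (v + w) = gam u v * gam u w.
Hypothesis gamvv : forall v, gam v v = 1.
Hypothesis WM : forall v w, W v *m W w = gam v w *: W (v + w).
Hypothesis W0 : W 0 = 1%:M.
Hypothesis W_commutant : forall A : 'M[F]_D, (forall v, W v *m A = A *m W v) -> exists c, A = c%:M.
Hypothesis W_tr : forall v, \tr (W v) = if v == 0 then D%:R else 0.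
Hypothesis cardV : #|{: V}| = (D ^ 2)%N.
Hypothesis D0 : D%:R != 0 :> F.
Hypothesis W_unitary : forall v, (map_mx sigma (W v))^T = W (- v).
Hypothesis gam_nondeg : forall v, (forall w, gam v w ^+ 2 = 1) -> v = 0.
Hypothesis gam_char : forall lam : V -> F, {morph lam : v w / v + w >-> v * w} -> lam 0 = 1 ->
  exists w, forall v, lam v = gam v w ^+ 2.
Hypothesis gam_Sp : forall s : 'M['F_p]_N, s *m J *m s^T = J ->
  forall v w, gam (v *m s) (w *m s) = gam v w.
Hypothesis Sp_gam : forall s : 'M['F_p]_N,
  (forall v w, gam (v *m s) (w *m s) ^+ 2 = gam v w ^+ 2) -> s *m J *m s^T = J.
Local Notation Z := (ScalGL n F).
Local Notation T := (tens e).

Lemma D_gt0 : (0 < D)%N.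
Proof. by rewrite lt0n; apply: contraNneq D0 => ->. Qed.

Lemma gam_sqr v w : gam v w * (gam w v)^-1 = gam v w ^+ 2.
Proof.
by rewrite expr2; congr (_ * _); apply: (mulfI (gam0 w v)); rewrite mulfV // (gamC gamDl gamDr gamvv).
Qed.

(** The commutator pairing is the square of the cocycle, because [gam w v] is the inverse of
    [gam v w]; hence the squares in the hypotheses on [gam]. *)
Lemma W_comm v w : W v *m W w = gam v w ^+ 2 *: (W w *m W v).
Proof. by rewrite !WM [w + v]addrC scalerA -gam_sqr mulfVK. Qed.

Lemma TWM (A A' : 'M[F]_D) (B B' : 'M[F]_k.-1.+1) : T A B *m T A' B' = T (A *m A') (B *m B').
Proof. exact: (tensM eK e'K). Qed.

Lemma weyl_lift : exists g : V -> {'GL_n[F]}, forall v, GLval (g v) = T (W v) 1%:M.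
Proof.
apply: (@fin_all_exists V (fun=> {'GL_n[F]}) (fun v g => GLval g = T (W v) 1%:M)) => v; apply: GL_exists.
have : T (W v) 1%:M *m T (W (- v)) 1%:M = 1%:M.
  by rewrite TWM (WV gam0 gamDr gamvv WM W0) mulmx1 (tens1 _ eK).
by case/mulmx1_unit.
Qed.

Section Lift.
Variable g : V -> {'GL_n[F]}.
Hypothesis gE : forall v, GLval (g v) = T (W v) 1%:M.

Definition weyl_coset v := coset Z (g v).
Local Notation th := weyl_coset.

Lemma lift_mul v w : GLval (g v * g w)%g = gam v w *: GLval (g (v + w)).
Proof. by rewrite GL_MxE !gE TWM WM mulmx1 tensZl. Qed.

Lemma lift_comm v w : GLval (g v * g w)%g = gam v w ^+ 2 *: GLval (g w * g v)%g.
Proof. by rewrite !GL_MxE !gE !TWM W_comm mulmx1 tensZl. Qed.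

Lemma scale_coset (x y : {'GL_n[F]}) (c : F) : GLval x = c *: GLval y -> coset Z x = coset Z y.
Proof.
move=> E; have c0 : c != 0.
  by apply: contraTneq (GL_unit x) => c0; rewrite E c0 scale0r unitr0.
apply: (mulIg (coset Z y)^-1%g); rewrite mulgV -coset_ScalGLV -coset_ScalGLM; apply/eqP.
rewrite coset_ScalGL1; apply/ScalGLP; exists c => //.
rewrite GL_MxE E -scalemxAl -GL_MxE mulgV; exact: scalemx1.
Qed.

Lemma weyl_cosetM : {in [set: V]%G &, {morph th : v w / (v * w)%g >-> (v * w)%g}}.
Proof.
move=> v w _ _; rewrite /th -coset_ScalGLM; apply/esym.
exact: scale_coset (lift_mul v w).
Qed.
Canonical weyl_coset_morphism := Morphism weyl_cosetM.

Lemma lift_scal_eq0 v (c : F) : (forall w, GLval (g v * g w)%g = c *: GLval (g w * g v)%g) -> c = 1 -> v = 0.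
Proof.
move=> h c1; apply: gam_nondeg => w; have := h w; rewrite lift_comm c1.
exact: GL_scaler_inj.
Qed.

(** [T 1%:M B] commutes with every [g w], which puts v in the radical of the pairing. This gives
    both the injectivity of [weyl_coset] and the trivial intersection of E with the block
    subgroup. *)
Lemma coset_tens_eq0 v (x : {'GL_n[F]}) B : GLval x = T 1%:M B -> th v = coset Z x -> v = 0.
Proof.
move=> xE /coset_ScalGL_eq[a a0 Ea]; apply: (lift_scal_eq0 (c := 1)) => // w.
rewrite scale1r !GL_MxE Ea -scalemxAl -scalemxAr xE gE !TWM.
by rewrite !mulmx1 !mul1mx.
Qed.

Lemma weyl_coset_injm : 'injm weyl_coset_morphism.
Proof.
apply/subsetP => v /morphpreP[_ /set1P v1]; apply/set1P.
apply: (@coset_tens_eq0 v 1%g 1%:M); first by rewrite (tens1 _ eK).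
by rewrite [LHS]v1 morph1.
Qed.

Lemma weyl_coset_inj : injective th.
Proof. by move=> v w; apply: (injmP weyl_coset_injm); rewrite inE. Qed.

Definition weylE := (weyl_coset_morphism @* [set: V])%G.
Local Notation E := weylE.

Lemma weylEP x : reflect (exists v, x = th v) (x \in E).
Proof.
apply: (iffP morphimP) => [[v _ _ ->]|[v ->]]; first by exists v.
by exists v; rewrite ?inE.
Qed.

Lemma weylE_PGU : E \subset PGU n sigma.
Proof.
apply/subsetP => _ /weylEP[v ->]; apply: mem_quotient; apply/GU_P.
rewrite gE map_tens tr_tens W_unitary map_mx1 trmx1 TWM (WVl gam0 gamDl gamvv WM W0).
by rewrite mulmx1 (tens1 _ eK).
Qed.

Lemma weylE_abelem : p.-abelem E.
Proof. by apply: morphim_abelem; exact: mx_Fp_abelem. Qed.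

Lemma card_weylE : #|E| = (p ^ (2 * m))%N.
Proof.
rewrite card_injm ?weyl_coset_injm // cardsT card_mx card_Fp // mul1n prednK //.
by rewrite muln_gt0.
Qed.

(** In a torus all lifts would commute, so the nonzero vector [delta_mx 0 0] would be in the radical
    of the pairing. *)
Lemma weylE_nontoral (L : fieldType) (iota : {rmorphism F -> L}) : ~ in_max_torus iota E.
Proof.
move=> [h [hu hd]].
have v0 : delta_mx 0 0 = 0 :> V; last first.
  by move/rowP/(_ 0): v0; rewrite !mxE !eqxx => /eqP; rewrite oner_eq0.
apply: (lift_scal_eq0 (c := 1)) => // w; rewrite scale1r; apply: (map_mx_inj (f := iota)).
have := hd _ (introT (weylEP _) (ex_intro _ _ (erefl (th (delta_mx 0 0))))).
have := hd _ (introT (weylEP _) (ex_intro _ _ (erefl (th w)))).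
set A := map_mx iota (GLval (g w)); set B := map_mx iota (GLval (g (delta_mx 0 0))).
move=> /diag_mxP[a Ea] /diag_mxP[b Eb]; rewrite !GL_MxE !map_mxM /= -/A -/B.
have Ea' : A = invmx h *m diag_mx a *m h by rewrite -Ea !mulmxA mulVmx // mul1mx mulmxKV.
have Eb' : B = invmx h *m diag_mx b *m h by rewrite -Eb !mulmxA mulVmx // mul1mx mulmxKV.
rewrite Ea' Eb' -!mulmxA !(mulmxA h) mulmxV // !mul1mx !(mulmxA (diag_mx _)).
by rewrite diag_mxC.
Qed.

Lemma T1_inj : injective (T 1%:M : 'M[F]_k.-1.+1 -> _).
Proof. exact: (tens1_inj e'K (Ordinal D_gt0)). Qed.

Lemma T1_scalar (a : F) : T 1%:M a%:M = a%:M.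
Proof. by have := tensZr e a 1%:M 1%:M; rewrite (tens1 _ eK) !scalemx1. Qed.

Section Block.
Variable h : {'GL_k[F]} -> {'GL_n[F]}.
Hypothesis hE : forall x, GLval (h x) = T 1%:M (GLval x).

Lemma block_GU x : (h x \in GU n sigma) = (x \in GU k sigma).
Proof.
apply/GU_P/GU_P; rewrite hE map_tens tr_tens map_mx1 trmx1 TWM mulmx1; last by move=> ->; exact: tens1.
by move=> xU; apply: T1_inj; rewrite xU (tens1 _ eK).
Qed.

Definition block_coset x := coset Z (h x).

Lemma block_cosetM : {in GU_group k sigma &, {morph block_coset : x y / (x * y)%g}}.
Proof.
move=> x y _ _; rewrite /block_coset -coset_ScalGLM; congr (coset _ _).
by apply: GLval_inj; rewrite [RHS]GL_MxE !hE TWM mulmx1.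
Qed.
Canonical block_coset_morphism := Morphism block_cosetM.

Lemma ker_block_coset : 'ker block_coset_morphism = ScalGL k F :&: GU k sigma.
Proof.
have e1 x : (block_coset x == 1%g) = (x \in ScalGL k F).
  rewrite coset_ScalGL1; apply/ScalGLP/ScalGLP => -[a a0 Ea]; exists a => //.
    by apply: T1_inj; rewrite T1_scalar -Ea hE.
  by rewrite hE Ea T1_scalar.
apply/setP => x; rewrite [RHS]inE -e1; apply/morphpreP/andP => [[Gx /set1P->]|[/eqP x1 Gx]] //.
by split=> //; apply/set1P.
Qed.

Definition blockH := (block_coset_morphism @* GU_group k sigma)%G.

Lemma blockH_isog : PGU k sigma \isog blockH.
Proof.
apply: isog_trans (first_isog block_coset_morphism).
rewrite isog_sym ker_block_coset; apply: second_isog.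
by rewrite ScalGL_norm subsetT.
Qed.

(** An x representing an element of the centralizer commutes with each [g v] up to a scalar [lam v],
    and [lam] is a character of V. By [gam_char] some [g w] has the same commutation scalars, and
    the quotient of x by it lies in the second tensor factor. *)
Lemma centralizer_weylE : weylE \x blockH = 'C_(PGU n sigma)(weylE).
Proof.
have cEH : blockH \subset 'C(weylE).
  apply/centsP => _ /morphimP[x _ _ ->] _ /weylEP[v ->] /=.
  rewrite /commute -[block_coset x]/(coset Z (h x)) -!coset_ScalGLM; congr (coset _ _).
  by apply: GLval_inj; rewrite GL_MxE [RHS]GL_MxE !gE !hE !TWM !mulmx1 !mul1mx.
have tiEH : weylE :&: blockH = 1%g.
  apply/trivgP/subsetP => y /setIP[/weylEP[v ->] /morphimP[x _ _ Ey]]; apply/set1P.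
  by rewrite (coset_tens_eq0 (hE x) Ey) -[1%g](morph1 weyl_coset_morphism).
have sH : blockH \subset PGU n sigma.
  by apply/subsetP => _ /morphimP[x _ Ux ->]; apply: mem_quotient; rewrite block_GU.
rewrite dprodE //; apply/eqP; rewrite eqEsubset mul_subG ?subsetI ?weylE_PGU ?sH ?cEH //=; last first.
  by apply: abelem_abelian weylE_abelem.
apply/subsetP => _ /setIP[/morphimP[x _ Ux ->] /centP cx].
have lamP v : exists2 a, a != 0 & GLval (x^-1 * g v * x)%g = a *: GLval (g v).
  apply: coset_ScalGL_eq; rewrite !coset_ScalGLM coset_ScalGLV -mulgA.
  by rewrite -[coset Z (g v)]/(th v) -(cx (th v)) ?mulKg //; apply/weylEP; exists v.
have /(@fin_all_exists V (fun=> F))[lam lamP'] : forall v, exists a, a != 0 /\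
    GLval (g v) *m GLval x = a *: (GLval x *m GLval (g v)).
  move=> v; have [a a0 Ea] := lamP v; exists a; split=> //.
  by have := congr1 (mulmx (GLval x)) Ea; rewrite -scalemxAr -!GL_MxE !mulgA mulgV mul1g.
have lam_neq0 v : lam v != 0 by case: (lamP' v).
have lamE v : GLval (g v) *m GLval x = lam v *: (GLval x *m GLval (g v)) by case: (lamP' v).
have lamD : {morph lam : v w / v + w >-> v * w}.
  move=> v w; apply: (mulfI (gam0 v w)); rewrite mulrC [RHS]mulrC.
  have : GLval (g v * g w)%g *m GLval x = (lam v * lam w) *: (GLval x *m GLval (g v * g w)%g).
    by rewrite GL_MxE -mulmxA (lamE w) -scalemxAr [X in _ *: X = _]mulmxA (lamE v) -scalemxAl -mulmxA scalerA mulrC.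
  rewrite lift_mul -scalemxAl lamE -scalemxAr !scalerA mulrC -GL_MxE.
  exact: GL_scaler_inj.
have lam0 : lam 0 = 1.
  by apply: (mulfI (lam_neq0 0)); rewrite -lamD addr0 mulr1.
have [w Ew] := gam_char lamD lam0.
(* Dividing by [g w] cancels [lam], so y commutes with every [g v]. *)
pose y := (x * (g w)^-1)%g.
have [B EB] : exists B, GLval y = T 1%:M B.
  apply: (tens_commutant eK e'K W_commutant) => v; rewrite -gE.
  have gwv : GLval ((g w)^-1 * g v)%g = lam v *: GLval (g v * (g w)^-1)%g.
    have : GLval ((g w)^-1)%g *m GLval (g v * g w)%g *m GLval ((g w)^-1)%g =
        GLval ((g w)^-1)%g *m (gam v w ^+ 2 *: GLval (g w * g v)%g) *m GLval ((g w)^-1)%g by rewrite lift_comm.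
    by rewrite -scalemxAr -scalemxAl -!GL_MxE !mulgA mulgK mulVg mul1g Ew.
  have -> : GLval y = GLval x *m GLval ((g w)^-1)%g by exact: GL_MxE.
  by rewrite mulmxA lamE -scalemxAl -!mulmxA -[X in _ = _ *m X]GL_MxE gwv GL_MxE scalemxAr.
have yU : (map_mx sigma B)^T *m B = 1%:M.
  have yGU : y \in GU n sigma.
    rewrite groupM ?groupV // ; apply/GU_P.
    rewrite gE map_tens tr_tens W_unitary map_mx1 trmx1 TWM (WVl gam0 gamDl gamvv WM W0).
    by rewrite mulmx1 (tens1 _ eK).
  have /GU_P := yGU; rewrite EB map_tens tr_tens map_mx1 trmx1 TWM mulmx1 -(tens1 _ eK).
  exact: T1_inj.
have [_ uB] := mulmx1_unit yU.
have [b Eb] := GL_exists uB.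
have yE : y = h b by apply: GLval_inj; rewrite hE Eb.
have bU : b \in GU k sigma by apply/GU_P; rewrite Eb.
have Ex : coset Z x = (coset Z (h b) * th w)%g by rewrite -yE -coset_ScalGLM mulgKV.
have thE : th w \in weylE by apply/weylEP; exists w.
have hH : coset Z (h b) \in blockH by apply/morphimP; exists b.
by rewrite -[X in X \in _]/(coset Z x) Ex (centsP cEH _ hH _ thE) mem_mulg.
Qed.
End Block.

(** The adjoint of an intertwiner M intertwines in the opposite direction, so [Ms *m M] is a scalar
    c. It is fixed by [sigma], hence a norm [a ^+ q.+1], and [a^-1 *: M] is unitary. *)
Lemma unitary_intertwiner (s : 'M['F_p]_N) : s *m J *m s^T = J ->
  exists2 M : 'M[F]_D, (map_mx sigma M)^T *m M = 1%:M & forall v, W v *m M = M *m W (v *m s).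
Proof.
move=> sSp; have us := symp_unit m_gt0 sSp.
have sD : {morph (mulmxr s : V -> V) : v w / v + w} by move=> v w; exact: mulmxDl.
have s_inj : injective (mulmxr s : V -> V) by exact: can_inj (mulmxK us).
have [Y M0] := intertwiner_neq0 gam0 gamDl gamDr gamvv WM W0 W_tr D0 s_inj.
have uM := intertwiner_unit gam0 gamDl gamDr gamvv WM W0 W_commutant cardV D0 sD (gam_Sp sSp) M0.
have MP w := intertwinerP gam0 gamDl gamDr gamvv WM sD (gam_Sp sSp) Y w.
move: uM MP {M0}; set M := intertwiner _ _ _ => uM MP.
pose Ms := (map_mx sigma M)^T.
have MsP w : Ms *m W w = W (w *m s) *m Ms.
  have := congr1 (fun A => (map_mx sigma A)^T) (MP (- w)).
  by rewrite /= !map_mxM !trmx_mul !W_unitary opprK mulNmx opprK.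
have [c Ec] : exists c, Ms *m M = c%:M.
  apply: W_commutant => u; rewrite -(mulmxKV us u) mulmxA -MsP -[RHS]mulmxA.
  by rewrite -[M *m W _]MP !mulmxA.
have uMs : Ms \in unitmx by rewrite unitmx_tr map_unitmx.
have c0 : c != 0.
  have : (c%:M : 'M_D) \in unitmx by rewrite -Ec unitmx_mul uMs uM.
  by apply: contraTneq => ->; rewrite unitmxE det_scalar expr0n eqn0Ngt D_gt0 unitr0.
have sigK : involutive sigma.
  by move=> x; rewrite !sigmaE -exprM mulnn -cardF expf_card.
(* Taking adjoints in [Ms *m M = c%:M] preserves the left side and replaces c by [sigma c]. *)
have cq : c ^+ q = c.
  have := congr1 (fun A => (map_mx sigma A)^T) Ec.
  have MsK : (map_mx sigma Ms)^T = M by apply/matrixP => i j; rewrite !mxE sigK.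
  rewrite /= map_mxM trmx_mul MsK -/Ms Ec map_scalar_mx tr_scalar_mx => /matrixP/(_ (Ordinal D_gt0) (Ordinal D_gt0)).
  by rewrite !mxE eqxx !mulr1n /= sigmaE => <-.
have [a a0 aq] := norm_surjective q_gt1 cardF c0 cq.
exists (a^-1 *: M) => [|v]; last by rewrite -scalemxAl -scalemxAr MP.
rewrite map_mxZ [(_ *: _)^T]linearZ /= -scalemxAl -scalemxAr -/Ms Ec scalerA sigmaE.
by rewrite -exprSr exprVn aq scale_scalar_mx mulVf.
Qed.

Local Notation G := ('N_(PGU n sigma)(weylE)).

(** Conjugation by x permutes the [th v] additively, hence through a matrix A, and it preserves the
    commutator pairing of the lifts; [Sp_gam] turns this into the symplectic condition. *)
Lemma conj_lift_Sp (x : coset_of Z) : x \in G ->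
  exists2 s, s \in Sp m p & forall v, (th v ^ x)%g = th (v *m GLval s).
Proof.
case/setIP=> Px Nx.
have /(@fin_all_exists V (fun=> V))[phi phiE] v : exists w, (th v ^ x)%g = th w.
  by apply/weylEP; rewrite memJ_norm //; apply/weylEP; exists v.
have phiD : {morph phi : v w / v + w}.
  move=> v w; apply: weyl_coset_inj; rewrite -phiE.
  have tD u u' : th (u + u') = (th u * th u')%g by apply: weyl_cosetM; rewrite inE.
  by rewrite !tD conjMg !phiE.
pose A := \matrix_i phi (delta_mx 0 i).
have phiA v : phi v = v *m A by exact: additive_rV_mx.
have [y _ Ey] : exists2 y, y \in 'N(Z) & x = coset Z y.
  by exists (repr x); rewrite ?mem_ScalGL_norm ?coset_reprK.
have yP v : exists2 a, a != 0 & GLval (g v ^ y)%g = a *: GLval (g (v *m A)).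
  apply: coset_ScalGL_eq; rewrite -[RHS]/(th _) -phiA -phiE Ey /conjg.
  by rewrite !coset_ScalGLM coset_ScalGLV.
have [] := Sp_exists m_gt0 (A := A); last by move=> s sS Es; exists s => // v; rewrite phiE phiA Es.
apply: Sp_gam => v w; have [a a0 Ea] := yP v; have [b b0 Eb] := yP w.
have scalM c d (x1 x2 y1 y2 : {'GL_n[F]}) : GLval x1 = c *: GLval y1 -> GLval x2 = d *: GLval y2 ->
    GLval (x1 * x2)%g = (c * d) *: GLval (y1 * y2)%g.
  by move=> h1 h2; rewrite GL_MxE h1 h2 -scalemxAl -scalemxAr scalerA -GL_MxE.
have Evw := scalM _ _ _ _ _ _ Ea Eb; have Ewv := scalM _ _ _ _ _ _ Eb Ea.
have E1 : GLval ((g v * g w) ^ y)%g = gam v w ^+ 2 *: GLval ((g w * g v) ^ y)%g.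
  have L := lift_comm v w.
  by rewrite /conjg GL_MxE [in LHS]GL_MxE L -scalemxAl -scalemxAr -!GL_MxE.
move: E1; rewrite !conjMg Evw Ewv lift_comm !scalerA => /GL_scaler_inj E.
by apply: (mulfI (mulf_neq0 a0 b0)); rewrite E; ring.
Qed.

(** The action on V defines a homomorphism whose kernel is the centralizer; unitary intertwiners
    tensored with the identity make it surjective. *)
Lemma normalizer_weylE : (G / 'C_(PGU n sigma)(weylE))%g \isog Sp m p.
Proof.
have /(@fin_all_exists _ (fun=> {'GL_(2 * m)['F_p]}))[rho rhoP] : forall x, exists s, x \in G ->
    s \in Sp m p /\ forall v, (th v ^ x)%g = th (v *m GLval s).
  move=> x; have [/conj_lift_Sp[s sS sP]|] := boolP (x \in G); first by exists s.
  by exists 1%g.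
have GL_eq (s t : {'GL_(2 * m)['F_p]}) : (forall v : V, v *m GLval s = v *m GLval t) -> s = t.
  by move=> h; apply: GLval_inj; apply/row_matrixP => i; rewrite !rowE h.
(* Matrices act on row vectors from the right, as conjugation does, so the order of the factors is
   preserved. *)
have rhoM : {in G &, {morph rho : x y / (x * y)%g}}.
  move=> x y Gx Gy; apply: GL_eq => v; apply: weyl_coset_inj.
  have [_ xP] := rhoP x Gx; have [_ yP] := rhoP y Gy.
  have [_ <-] := rhoP (x * y)%g (groupM Gx Gy).
  by rewrite GL_MxE mulmxA -yP -xP conjgM.
pose f := Morphism rhoM.
have imf : f @* G = Sp m p.
  apply/setP => s; apply/morphimP/idP => [[x _ Gx ->]|sS]; first by case: (rhoP x Gx).
  have [M MU MP] : exists2 M : 'M[F]_D, (map_mx sigma M)^T *m M = 1%:M &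
      forall v, W v *m M = M *m W (v *m GLval s).
    by apply: unitary_intertwiner; apply/eqP; rewrite -in_Sp.
  have uT : T M 1%:M \in unitmx.
    have : T (map_mx sigma M)^T 1%:M *m T M 1%:M = 1%:M by rewrite TWM MU mulmx1 (tens1 _ eK).
    by case/mulmx1_unit.
  have [y Ey] := GL_exists uT.
  have yU : y \in GU n sigma.
    by apply/GU_P; rewrite Ey map_tens tr_tens map_mx1 trmx1 TWM MU mulmx1 (tens1 _ eK).
  have yJ v : (th v ^ coset Z y)%g = th (v *m GLval s).
    rewrite /th /conjg -coset_ScalGLV -!coset_ScalGLM; congr (coset _ _).
    apply: (mulgI y); rewrite mulKVg; apply: GLval_inj.
    by rewrite !GL_MxE !gE Ey !TWM MP.
  have Gy : coset Z y \in G.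
    rewrite inE mem_quotient //=; rewrite inE; apply/subsetP => _ /imsetP[_ /weylEP[v ->] ->].
    by rewrite yJ; apply/weylEP; exists (v *m GLval s).
  exists (coset Z y) => //; apply: GL_eq => v; apply: weyl_coset_inj.
  by have [_ <-] := rhoP _ Gy; rewrite yJ.
have kerf : 'ker f = 'C_(PGU n sigma)(weylE).
  apply/setP => x; apply/morphpreP/setIP => [[Gx /set1P fx]|[Px Cx]].
    have [Px _] := setIP Gx; split=> //; apply/centP => _ /weylEP[v ->].
    have [_ xP] := rhoP x Gx; apply/esym/commgP/conjg_fixP.
    by rewrite xP [rho x]fx mulmx1.
  have Gx : x \in G by rewrite inE Px (subsetP (cent_sub _)).
  split=> //; apply/set1P; apply: GL_eq => v; apply: weyl_coset_inj.
  have [_ <-] := rhoP x Gx; rewrite mulmx1; apply/conjg_fixP/commgP/esym.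
  by apply: (centP Cx); apply/weylEP; exists v.
by rewrite -imf -kerf; apply: first_isog.
Qed.
End Lift.

Lemma weyl_good_subgroup (L : fieldType) (iota : {rmorphism F -> L}) : (0 < k < n)%N ->
  exists E : {group coset_of Z}, good_subgroup p m q sigma iota E.
Proof.
move=> kn; have [g gE] := weyl_lift.
have [h hE] : exists h : {'GL_k[F]} -> {'GL_n[F]}, forall x, GLval (h x) = T 1%:M (GLval x).
  apply: (@fin_all_exists _ (fun=> {'GL_n[F]}) (fun x y => GLval y = T 1%:M (GLval x))) => x.
  apply: GL_exists; have : T 1%:M (GLval x) *m T 1%:M (GLval x^-1%g) = 1%:M.
    by rewrite TWM mulmx1 -GL_MxE mulgV (tens1 _ eK).
  by case/mulmx1_unit.
exists (weylE gE); split.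
- exact: weylE_PGU.
- by split; [exact: weylE_abelem | exact: card_weylE].
- exact: weylE_nontoral.
- exists k => //; have dC := centralizer_weylE gE hE; have dX := setX_dprod (weylE gE) (PGU_group k sigma).
  apply: (isog_dprod dC dX); first exact: isog_setX1.
  apply: isog_trans (isog_set1X _ _); rewrite isog_sym; exact: blockH_isog.
- exact: normalizer_weylE.
Qed.
End WeylGroup.

(** * Construction of E from the two conditions *)

Section Backward.
Variables (p m q n : nat) (F : finFieldType) (sigma : {rmorphism F -> F}).
Hypotheses (p_pr : prime p) (p_odd : odd p) (m_gt0 : (0 < m)%N) (n_gt0 : (0 < n)%N).
Hypotheses (npq : ~~ (p %| q)%N) (cardF : #|F| = (q ^ 2)%N) (q_gt1 : (1 < q)%N).
Hypothesis sigmaE : forall x : F, sigma x = x ^+ q.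
Hypotheses (p_n : (p ^ m %| n)%N) (p_q1 : (p %| q.+1)%N).
Local Notation N := (2 * m).-1.+1.
Local Notation V := 'rV['F_p]_N.

(** The unit group of F has order [(q - 1)(q + 1)], a multiple of p, so Cauchy's theorem applies. *)
Lemma exists_zeta : exists2 zeta : F, zeta ^+ p = 1 & zeta != 1.
Proof.
have pU : (p %| #|[set: {unit F}]|)%N.
  rewrite card_finField_unit cardF (_ : (q ^ 2).-1 = q.-1 * q.+1)%N ?dvdn_mull //; lia.
have [u _ ou] := Cauchy p_pr pU.
exists (val u); first by rewrite -FinRing.val_unitX -ou expg_order.
apply: contraTneq (prime_gt1 p_pr) => u1; rewrite -ou.
by rewrite (_ : u = 1%g) ?order1 //; apply: val_inj.
Qed.

Section Zeta.
Variable zeta : F.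
Hypotheses (zetap : zeta ^+ p = 1) (zeta1 : zeta != 1).
Local Notation chi := (@addchar p F zeta).
Local Notation W := (@weyl m p F zeta).

Lemma p_neq0 : p%:R != 0 :> F.
Proof. exact: natf_neq0_coprime_card npq cardF. Qed.

(** As p divides [q.+1], raising a p-th root of unity to the power q inverts it. *)
Lemma sigma_addchar x : sigma (chi x) = chi (- x).
Proof.
rewrite sigmaE addcharN //; apply: (mulfI (addchar_neq0 p_pr zetap x)).
rewrite mulfV ?addchar_neq0 // -exprS /addchar -exprM; case/dvdnP: p_q1 => j ->.
by rewrite mulnA mulnC exprM zetap expr1n.
Qed.

Lemma weyl_unitary v : (map_mx sigma (W v))^T = W (- v).
Proof.
apply/matrixP => x y; rewrite !mxE posnN momnN [X in _ = if X then _ else _]eq_sym subr_eq.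
case: eqP => [E|_]; last by rewrite rmorph0.
rewrite sigma_addchar; congr (chi _).
rewrite E !(dotDr, dotNl, dotNr) -[dot (momn v) (posn v)](half_sum p_pr p_odd) (dotC (momn v) (posn v)).
ring.
Qed.

Definition cocycle (v w : V) : F := chi (2%:R^-1 * sform v w).

Lemma cocycle_sqr v w : cocycle v w ^+ 2 = chi (sform v w).
Proof. by rewrite expr2 -addcharD // half_sum. Qed.

Lemma cocycleDl u v w : cocycle (u + v) w = cocycle u w * cocycle v w.
Proof. by rewrite /cocycle sformDl mulrDr addcharD. Qed.

Lemma cocycleDr u v w : cocycle u (v + w) = cocycle u v * cocycle u w.
Proof. by rewrite /cocycle sformDr mulrDr addcharD. Qed.

Lemma cocyclevv v : cocycle v v = 1.
Proof. by rewrite /cocycle sform_dot // dotC subrr mulr0. Qed.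

Lemma cocycle_nondeg v : (forall w, cocycle v w ^+ 2 = 1) -> v = 0.
Proof.
by move=> h; apply: (sform_nondeg m_gt0) => w; apply: (addchar_eq1 p_pr zetap zeta1); rewrite -cocycle_sqr.
Qed.

Lemma cocycle_Sp (s : 'M['F_p]_N) : s *m Jsymp m p *m s^T = Jsymp m p ->
  forall v w, cocycle (v *m s) (w *m s) = cocycle v w.
Proof. by move=> sS v w; rewrite /cocycle sform_Sp. Qed.

(** [chi] is injective, so equal squared cocycles mean equal symplectic forms, compared on basis
    vectors. *)
Lemma Sp_cocycle (s : 'M['F_p]_N) :
  (forall v w, cocycle (v *m s) (w *m s) ^+ 2 = cocycle v w ^+ 2) ->
  s *m Jsymp m p *m s^T = Jsymp m p.
Proof.
move=> h; have sf v w : sform (v *m s) (w *m s) = sform v w.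
  apply/eqP; rewrite -subr_eq0; apply/eqP/(addchar_eq1 p_pr zetap zeta1).
  by rewrite addcharD // addcharN // -!cocycle_sqr h mulfV // expf_neq0 // addchar_neq0.
apply/matrixP => i j; have := sf (delta_mx 0 i) (delta_mx 0 j).
have ent (A : 'M['F_p]_N) : ((delta_mx 0 i : V) *m A *m (delta_mx 0 j : V)^T) 0 0 = A i j.
  by rewrite -rowE trmx_delta -colE !mxE.
by rewrite /sform trmx_mul !mulmxA ent -(mulmxA _ s) -(mulmxA _ (s *m _)) ent.
Qed.

Lemma cocycle_char (lam : V -> F) : {morph lam : v w / v + w >-> v * w} -> lam 0 = 1 ->
  exists w, forall v, lam v = cocycle v w ^+ 2.
Proof.
move=> lamD lam0.
have lamX v k : lam (v *+ k) = lam v ^+ k.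
  by elim: k => [|k IH]; rewrite ?mulr0n // mulrS lamD IH exprS.
have [l lE] : exists l : 'rV['F_p]_N, forall i, lam (delta_mx 0 i) = chi (l 0 i).
  have /fin_all_exists[f fE] : forall i : 'I_N, exists x, lam (delta_mx 0 i) = chi x.
    move=> i; apply: (addchar_root p_pr zetap zeta1); rewrite -lamX -scaler_nat.
    by rewrite pchar_Fp_0 // scale0r.
  by exists (\row_i f i) => i; rewrite mxE.
(* The row [l] collects the exponents of [lam] on the basis; since [J *m J^T = 1], the form pairs v
   with [l *m J] to the ordinary product [v *m l^T]. *)
exists (l *m Jsymp m p) => v; rewrite cocycle_sqr.
have -> : sform v (l *m Jsymp m p) = (v *m l^T) 0 0.
  by rewrite /sform trmx_mul tr_J // mulNmx mulmxN mulmxA -(mulmxA v) mul_JJ // mulmxN mulNmx opprK mulmx1.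
rewrite [v in LHS]row_sum_delta (big_morph _ lamD lam0) mxE.
rewrite (big_morph _ (addcharD p_pr zetap) (addchar0 _ zeta)); apply: eq_bigr => i _.
have chiX x j : chi (x *+ j) = chi x ^+ j.
  by elim: j => [|j IH]; rewrite ?mulr0n // mulrS addcharD // IH exprS.
by rewrite mxE -[v 0 i]natr_Zp scaler_nat lamX lE mulr_natl chiX.
Qed.
End Zeta.

Lemma good_subgroup_exists (L : fieldType) (iota : {rmorphism F -> L}) :
  exists E : {group coset_of (ScalGL n F)}, good_subgroup p m q sigma iota E.
Proof.
have [zeta zetap zeta1] := exists_zeta.
pose D := #|{: 'rV['F_p]_m}|.
have DE : D = (p ^ m)%N by rewrite /D card_mx card_Fp // mul1n.
pose k := (n %/ p ^ m)%N.
have nE : (n = D * k)%N by rewrite DE mulnC divnK.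
have k_gt0 : (0 < k)%N by rewrite divn_gt0 ?expn_gt0 ?prime_gt0 // dvdn_leq.
have eC : n.-1.+1 = #|{: 'I_D * 'I_k.-1.+1}|.
  by rewrite card_prod !card_ord !prednK.
pose e (x : 'I_n.-1.+1) : 'I_D * 'I_k.-1.+1 := enum_val (cast_ord eC x).
pose e' (y : 'I_D * 'I_k.-1.+1) : 'I_n.-1.+1 := cast_ord (esym eC) (enum_rank y).
have eK : cancel e e' by move=> x; rewrite /e /e' enum_valK cast_ordK.
have e'K : cancel e' e by move=> x; rewrite /e /e' cast_ordKV enum_rankK.
have p0 := p_neq0.
apply: (@weyl_good_subgroup p m q n k F sigma D (@weyl m p F zeta) (@cocycle zeta) e e') => //.
- by move=> v w; apply: addchar_neq0.
- exact: cocycleDl.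
- exact: cocycleDr.
- exact: cocyclevv.
- exact: weylM.
- exact: weyl0.
- exact: weyl_commutant.
- exact: weyl_tr.
- exact: card_phase.
- exact: natD_neq0.
- exact: weyl_unitary.
- exact: cocycle_nondeg.
- exact: cocycle_char.
- exact: cocycle_Sp.
- exact: Sp_cocycle.
(* The strict bound [k < n] comes from [p ^ m > 1], as m is positive. *)
- rewrite k_gt0 /= ltn_Pdiv // -(expn0 p) ltn_exp2l ?prime_gt1 //.
Qed.
End Backward.

Local Close Scope ring_scope.
Local Close Scope group_scope.
Unset Implicit Arguments.

(* F plays the role of F_{q^2} (so that PGU_n(q) <= PGL_n(F_{q^2})),
   sigma is the q-Frobenius x |-> x^q on F, and (L, iota) is an algebraic
   closure K of F (hence of F_q). *)
Theorem theorem4p33 (p m q n : nat) (F : finFieldType)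
    (sigma : {rmorphism F -> F}) (L : closedFieldType)
    (iota : {rmorphism F -> L}) :
  prime p -> odd p -> (1 <= m)%N ->
  (exists r e : nat, [/\ prime r, (0 < e)%N & q = (r ^ e)%N]) ->
  ~~ (p %| q)%N ->
  #|F| = (q ^ 2)%N ->
  (forall x : F, sigma x = (x ^+ q)%R) ->
  (forall y : L, exists P : {poly F}, (P != 0)%R /\ root (map_poly iota P) y) ->
  (1 <= n)%N ->
  ((exists E : {group coset_of (ScalGL n F)}, good_subgroup p m q sigma iota E) ->
     (p ^ m %| n)%N /\ q.+1 = 0 %[mod p])
  /\
  ((p ^ m %| n)%N -> q.+1 = 0 %[mod p] ->
     exists E : {group coset_of (ScalGL n F)}, good_subgroup p m q sigma iota E).
Proof.
move=> p_pr p_odd m_gt0 [r [e [r_pr e_gt0 qE]]] npq cardF sigmaE _ n_gt0; split.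
  case=> E goodE; split.
    exact: (good_dvdn_n p_pr p_odd m_gt0 n_gt0 npq cardF goodE).
  by apply/eqP; rewrite mod0n; exact: (good_dvdn_qS p_pr npq cardF sigmaE goodE).
move=> p_n /eqP; rewrite mod0n => p_q1.
have q_gt1 : (1 < q)%N by rewrite qE -(expn0 r) ltn_exp2l ?prime_gt1.
exact: (good_subgroup_exists p_pr p_odd m_gt0 n_gt0 npq cardF q_gt1 sigmaE p_n p_q1).
Qed.
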